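(* Let $N$ be a squarefree positive integer with $\gcd(N,6)=1$, and let $d$ be a positive divisor of $N$. Then the constant term of $f_{\theta_{N-1}}$ (as a modular form of weight $(N-1)/2$) at the cusp $1/d$ is $$[f_{\theta_{N-1}}]_{1/d}=i^{(1-Nd)/2}\sqrt{d/N}.$$
   Context: $q=e^{2\pi iz}$; $\theta_m(x)=\sum_{i=1}^mx_i^2+\sum_{1\le i<j\le m}x_ix_j$ and $f_{\theta_m}(z)=\sum_{x\in\mathbb{Z}^m}q^{\theta_m(x)}$, which for $m=N-1$ is a modular form of weight $(N-1)/2$ on $\Gamma_0(N)$. For $f$ of weight $k$ and coprime $a\in\mathbb{Z}$, $c\in\mathbb{N}_0$, $[f]_{a/c}=\lim_{z\to i\infty}(cz+\delta)^{-k}f\big(\frac{az+b}{cz+\delta}\big)$ for any $b,\delta$ with $\begin{pmatrix}a&b\\c&\delta\end{pmatrix}\in SL_2(\mathbb{Z})$. *)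

(* Defs.v *)
From HB Require Import structures.
From mathcomp Require Import all_boot all_order all_algebra.
From mathcomp Require Import complex.
From mathcomp Require Import all_classical all_reals all_analysis.
From mathcomp Require summability.

Set Implicit Arguments.
Unset Strict Implicit.
Unset Printing Implicit Defensive.

Import Order.TTheory GRing.Theory Num.Theory.
Import numFieldNormedType.Exports.

Local Open Scope classical_set_scope.
Local Open Scope ring_scope.

Definition squarefree (n : nat) : Prop :=
  forall p : nat, prime p -> ~~ (p ^ 2 %| n)%N.

Definition cexp (R : realType) (z : R[i]) : R[i] :=
  ((expR (complex.Re z))%:C * (cos (complex.Im z) +i* sin (complex.Im z)))%C.

(* q = e^{2 pi i z} *)
Definition qexp (R : realType) (z : R[i]) : R[i] :=
  cexp (2 * (pi : R)%:C%C * 'i%C * z).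

Definition theta (m : nat) (x : 'rV[int]_m) : int :=
  \sum_(i < m) x 0 i ^+ 2 +
  \sum_(i < m) \sum_(j < m | (i < j)%N) x 0 i * x 0 j.

(* summability.sum is the unconditional sum: the limit of the partial sums
   along the directed set of finite subsets of Z^m. It converges (absolutely)
   for 0 < Im z, and takes a junk value where it does not converge. *)
Definition f_theta (R : realType) (m : nat) (z : R[i]) : R[i] :=
  summability.sum (fun x : 'rV[int]_m => qexp z ^ theta x : R[i]^o).

(* z --> i oo, that is, Im z --> +oo with no constraint on Re z. *)
Definition i_infty (R : realType) : set_system R[i] :=
  filter_from setT (fun M : R => [set z | M < complex.Im z]).

Global Instance i_infty_filter (R : realType) : ProperFilter (@i_infty R).
Proof.
apply: filter_from_proper.
  apply: filter_fromT_filter; first by exists 0.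
  move=> M M'; exists (Num.max M M') => z /=.
  by rewrite gt_max => /andP[].
by move=> M _; exists (0 +i* (M + 1))%C => /=; rewrite ltrDl.
Qed.

(* [f]_{a/c} = l for f of integral weight k: the limit exists and equals l for
   every completion of the column (a, c) to a matrix of SL_2(Z). The coprimality
   conjunct rules out pairs (a, c) having no completion at all. *)
Definition cusp_constant_term (R : realType) (k : int) (f : R[i] -> R[i])
    (a : int) (c : nat) (l : R[i]) : Prop :=
  coprimez a c /\
  forall b delta : int, a * delta - b * c%:Z = 1 ->
    (c%:R * z + delta%:~R) ^ (- k) *
      f ((a%:~R * z + b%:~R) / (c%:R * z + delta%:~R)) @[z --> @i_infty R]
    --> (l : R[i]^o).

(* Main.v *)
(** Write [N = M d], [e(x) = exp (2 pi i x)], and let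
    [psi(l, a) = sum_(k in Z) exp (- pi l k^2) e(k a)].

    The sum-zero vectors and the multiples of [(1, ..., 1)] span, orthogonally, the sublattice
    of [Z^N] of vectors whose coordinate sum is divisible by [N].  Detecting this divisibility
    with the characters of [Z/N] gives an identity between one-dimensional theta series only:
    [sum_(r < N) psi(-iz, 1/2 - r/N)^N = N f(z) psi(-iNz, N/2)].

    At [z' = Z / (d Z + 1)] two applications of the Poisson formula, to [-1/z' = -d - 1/Z] and
    then to [-1/Z], express the left-hand side through [psi(-iZ / M^2, _)], and one application
    does the same for [psi(-iNz', N/2)].  Each of these series tends to [1] as [Im Z] tends to
    infinity, so the limit can be read off; the square roots in the three Poisson formulas
    combine into [e(1/8)] and an integral power of [d Z + 1].

    The Poisson formula for complex Gaussians, [s sum_n exp (- pi s^2 (n + a)^2) =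
    psi(s^-2, a)], is obtained from Fourier inversion on [Z/L] as [L] grows: the Fourier
    coefficients are Riemann sums of Gaussians along lines of the complex plane, whose limit
    does not depend on the line, and two summations by parts dominate them by a multiple of
    [1 / n^2]. *)

Require Import Defs.
From HB Require Import structures.
From mathcomp Require Import all_boot all_order all_algebra finmap.
From mathcomp Require Import complex.
From mathcomp Require Import all_classical all_reals all_analysis.
From mathcomp Require summability.
From mathcomp Require Import ring lra zify.

Set Implicit Arguments.
Unset Strict Implicit.
Unset Printing Implicit Defensive.

Import Order.TTheory GRing.Theory Num.Theory.
Import numFieldNormedType.Exports.
Import ComplexField.Normc.

Local Open Scope classical_set_scope.
Local Open Scope ring_scope.

(** * Unconditional sums of complex families *)

#[global] Arguments normc {R} x : simpl never.
#[global] Arguments cexp {R} z : simpl never.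

(** The shift 1/2 in the characteristics [1/2 - r/N] makes the translation by [d] harmless: since
    x^2 + x is even, it multiplies the term of index x only by a constant and by e(xr/M). In the
    product identity the shift costs the sign (-1)^(coordinate sum), which on the sublattice falls
    entirely on the multiples of (1, ..., 1), so that [f_theta] itself is not affected. In the limit
    only the d indices r divisible by M survive, and the N-th powers of their phases agree. Square
    roots are pinned down by the sector |arg s| < pi/4, on which squaring is injective with values
    in the right half-plane; signs follow from positivity of real parts. Poisson summation is proved
    without forming an integral: the normalisation comes from the self-dual case s = 1, a = 0, where
    both sides are the same nonzero series. A completion of the column (1, d) has delta = 1 + bd, so
    it amounts to Z = z + b, and the estimates depend on Im z alone. *)

Section complex_norm.
Variable R : realType.
Implicit Types z w : R[i].

(** The norm of [R[i]] takes its values in [R[i]]; estimates use the real-valued [normc] instead,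
    within reach of [lra] and [nra]. *)
Lemma normcE z : `|z| = (normc z)%:C%C.
Proof. by []. Qed.

Lemma normc_ge0 z : 0 <= normc z.
Proof. by rewrite -ler0c -normcE. Qed.

Lemma normcX z n : normc (z ^+ n) = normc z ^+ n.
Proof.
by elim: n => [|n IH]; rewrite ?expr0 ?normc1// !exprS normcM IH.
Qed.

Lemma normc_real (x : R) : normc x%:C%C = `|x|.
Proof. by rewrite /normc/= expr0n/= addr0 sqrtr_sqr. Qed.

Lemma normcB z w : normc (z - w) = normc (w - z).
Proof. by rewrite -normcN opprB. Qed.

Lemma ler_normc_sum (I : Type) (s : seq I) (P : pred I) (F : I -> R[i]) :
  normc (\sum_(i <- s | P i) F i) <= \sum_(i <- s | P i) normc (F i).
Proof.
elim/big_rec2: _ => [|i y x _ h]; first by rewrite normc0.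
by rewrite (le_trans (le_normcD _ _))// lerD2l.
Qed.

Lemma normc_Re z : `|complex.Re z| <= normc z.
Proof.
case: z => a b; rewrite /normc/= -[leLHS]sqrtr_sqr ler_wsqrtr//.
by rewrite lerDl sqr_ge0.
Qed.

Lemma normc_Im z : `|complex.Im z| <= normc z.
Proof.
case: z => a b; rewrite /normc/= -[leLHS]sqrtr_sqr ler_wsqrtr//.
by rewrite lerDr sqr_ge0.
Qed.

Lemma normc_eq0_small z : (forall e : R, 0 < e -> normc z <= e) -> z = 0.
Proof.
move=> h; apply: eq0_normc; apply/eqP; rewrite eq_le normc_ge0 andbT.
by apply/ler_addgt0Pr => e e0; rewrite add0r h.
Qed.

End complex_norm.

Section unconditional_sum.
Variable R : realType.
Local Open Scope fset_scope.
Local Open Scope ring_scope.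

Definition has_sum (I : choiceType) (a : I -> R[i]) (l : R[i]) : Prop :=
  forall e : R, 0 < e -> exists A : {fset I}, forall B : {fset I}, A `<=` B ->
    normc (\sum_(i <- B) a i - l) < e.

Definition sum_bound (I : choiceType) (a : I -> R[i]) (K : R) : Prop :=
  forall B : {fset I}, \sum_(i <- B) normc (a i) <= K.

Definition abs_summable (I : choiceType) (a : I -> R[i]) : Prop :=
  exists K, sum_bound a K.

Definition csum (I : choiceType) (a : I -> R[i]) : R[i] :=
  summability.sum (a : I -> R[i]^o).

Lemma has_sum_csum (I : choiceType) (a : I -> R[i]) l :
  has_sum a l -> csum a = l.
Proof.
move=> al; apply: (@cvg_lim R[i]^o _ _ _ summability.totally_filter);
  first exact: norm_hausdorff.
apply/(@cvgrPdist_lt R[i] R[i]^o _ _ (@summability.totally_filter I)) => e e0.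
have /andP[/eqP eI eR] : (complex.Im e == 0) && (0 < complex.Re e).
  by move: e0; rewrite ltcE /= => /andP[-> ->].
have [A hA] := al _ eR; exists A => // B /= /hA.
rewrite /summability.partial_sum -(big_seq_fsetE _ B xpredT a)/= normcB -ltcR.
by have -> : e = (complex.Re e)%:C%C by rewrite [LHS]complexE eI mulr0 addr0.
Qed.

(** Once convergence to [l] is known, [m] need only be tested on finite sets of a convenient shape:
    sets enlarged by preimages in [csum_support], rectangles in [csum_prod]. *)
Lemma has_sum_cofinal (I : choiceType) (a : I -> R[i]) l m : has_sum a l ->
  (forall (A : {fset I}) (e : R), 0 < e ->
     exists2 B, A `<=` B & normc (\sum_(i <- B) a i - m) < e) -> l = m.
Proof.
move=> al am; apply/eqP; rewrite -subr_eq0; apply/eqP/normc_eq0_small => e e0.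
have e2 : 0 < e / 2 by rewrite divr_gt0.
have [A hA] := al _ e2; have [B /hA h1 h2] := am A _ e2.
have -> : l - m = (\sum_(i <- B) a i - m) - (\sum_(i <- B) a i - l) by ring.
rewrite (le_trans (le_normcD _ _))// normcN; lra.
Qed.

Lemma sum_fset_le (I : choiceType) (r : I -> R) (A B : {fset I}) :
  (forall i, 0 <= r i) -> A `<=` B ->
  \sum_(i <- A) r i <= \sum_(i <- B) r i.
Proof.
move=> r0 AB; rewrite (big_fsetID _ (mem A) B)/=.
have -> : [fset x in B | x \in A] = A.
  by apply/fsetP => x; rewrite !inE; case: (boolP (x \in A)) => [/(fsubsetP AB)->|]; rewrite ?andbF.
by rewrite lerDl sumr_ge0.
Qed.

Lemma has_sum_real (I : choiceType) (r : I -> R) K : (forall i, 0 <= r i) ->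
  (forall B : {fset I}, \sum_(i <- B) r i <= K) ->
  exists l, has_sum (fun i => (r i)%:C%C) l.
Proof.
move=> r0 rK; pose S : set R := [set x | exists B : {fset I}, x = \sum_(i <- B) r i].
have hS : has_sup S.
  split; first by exists (\sum_(i <- fset0) r i); exists fset0.
  by exists K => _ [B ->].
exists (sup S)%:C%C => e e0.
have [_ [A ->] hA] := sup_adherent e0 hS; exists A => B AB.
rewrite -rmorph_sum -rmorphB normc_real ltr_norml.
have h1 : \sum_(i <- B) r i <= sup S by apply: ub_le_sup; [case: hS|exists B].
have h2 := sum_fset_le r0 AB; lra.
Qed.

Lemma has_sumD (I : choiceType) (a b : I -> R[i]) l m :
  has_sum a l -> has_sum b m -> has_sum (fun i => a i + b i) (l + m).
Proof.
move=> al bm e e0; have e2 : 0 < e / 2 by rewrite divr_gt0.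
have [A hA] := al _ e2; have [B hB] := bm _ e2; exists (A `|` B) => D.
rewrite fsubUset => /andP[/hA h1 /hB h2]; rewrite big_split/=.
have -> : \sum_(i <- D) a i + \sum_(i <- D) b i - (l + m) =
  (\sum_(i <- D) a i - l) + (\sum_(i <- D) b i - m) by ring.
rewrite (le_lt_trans (le_normcD _ _))//; lra.
Qed.

Lemma has_sumZ (I : choiceType) (a : I -> R[i]) (c l : R[i]) :
  has_sum a l -> has_sum (fun i => c * a i) (c * l).
Proof.
move=> al e e0; have c1 : 0 < normc c + 1 by rewrite ltr_pwDr// normc_ge0.
have [A hA] := al _ (divr_gt0 e0 c1); exists A => B /hA.
rewrite -mulr_sumr -mulrBr normcM ltr_pdivlMr//; apply: le_lt_trans.
by rewrite mulrC ler_wpM2l ?normc_ge0// lerDl.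
Qed.

Lemma eq_has_sum (I : choiceType) (a b : I -> R[i]) l :
  a =1 b -> has_sum a l -> has_sum b l.
Proof. by move=> /funext ->. Qed.

(** A real part p is the difference of |p| + p and |p|, two nonnegative families with bounded
    partial sums; each of them converges to its supremum. *)
Lemma csumP (I : choiceType) (a : I -> R[i]) :
  abs_summable a -> has_sum a (csum a).
Proof.
suff: abs_summable a -> exists l, has_sum a l.
  by move=> h /h[l al]; rewrite (has_sum_csum al).
move=> [K aK].
have pos (p : R[i] -> R) (pN : forall z, `|p z| <= normc z) :
    exists l, has_sum (fun i => (p (a i))%:C%C) l.
  have [||l1 h1] := @has_sum_real I (fun i => `|p (a i)| + p (a i)) (2 * K).
  - by move=> i; have := ler_norm (- p (a i)); rewrite normrN; lra.
  - move=> B; have := aK B; rewrite -(ler_pM2l (ltr0Sn R 1)); apply: le_trans.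
    rewrite mulr_sumr ler_sum// => i _; have := pN (a i).
    have := ler_norm (p (a i)); lra.
  have [||l2 h2] := @has_sum_real I (fun i => `|p (a i)|) K => //.
    by move=> B; apply: le_trans (aK B); apply: ler_sum.
  exists (l1 + (-1) * l2); apply: eq_has_sum (has_sumD h1 (has_sumZ (-1) h2)).
  by move=> i; rewrite rmorphD/=; ring.
have [l hl] := pos _ (@normc_Re R); have [m hm] := pos _ (@normc_Im R).
exists (l + 'i%C * m); apply: eq_has_sum (has_sumD hl (has_sumZ 'i%C hm)) => i.
by rewrite -complexE.
Qed.

Lemma csum_norm_le (I : choiceType) (a : I -> R[i]) K :
  sum_bound a K -> normc (csum a) <= K.
Proof.
move=> aK; apply/ler_addgt0Pr => e e0.
have [A hA] := csumP (ex_intro _ K aK) e0; have {hA} := hA A (fsubset_refl _).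
have := le_normcD (\sum_(i <- A) a i) (csum a - \sum_(i <- A) a i).
have -> : \sum_(i <- A) a i + (csum a - \sum_(i <- A) a i) = csum a by ring.
rewrite (normcB (csum a)).
have := ler_normc_sum A xpredT a; have := aK A; lra.
Qed.

Lemma sum_bound_le (I : choiceType) (a b : I -> R[i]) K :
  (forall i, normc (a i) <= normc (b i)) -> sum_bound b K -> sum_bound a K.
Proof. by move=> ab bK B; apply: le_trans (bK B); apply: ler_sum. Qed.

Lemma abs_summable_le (I : choiceType) (a b : I -> R[i]) :
  (forall i, normc (a i) <= normc (b i)) -> abs_summable b -> abs_summable a.
Proof. by move=> ab [K bK]; exists K; apply: sum_bound_le bK. Qed.

Lemma abs_summableD (I : choiceType) (a b : I -> R[i]) :
  abs_summable a -> abs_summable b -> abs_summable (fun i => a i + b i).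
Proof.
move=> [K aK] [L bL]; exists (K + L) => B.
apply: le_trans (lerD (aK B) (bL B)); rewrite -big_split/= ler_sum// => i _.
exact: le_normcD.
Qed.

Lemma abs_summableZ (I : choiceType) (a : I -> R[i]) c :
  abs_summable a -> abs_summable (fun i => c * a i).
Proof.
move=> [K aK]; exists (normc c * K) => B.
under eq_bigr do rewrite normcM.
by rewrite -mulr_sumr ler_wpM2l// normc_ge0.
Qed.

Lemma abs_summable_bigsum (I : choiceType) (J : Type) (s : seq J)
    (a : J -> I -> R[i]) : (forall j, abs_summable (a j)) ->
  abs_summable (fun i => \sum_(j <- s) a j i).
Proof.
move=> sa; elim: s => [|j s IH].
  by exists 0 => B; rewrite big1// => i _; rewrite big_nil normc0.
have [K hK] := abs_summableD (sa j) IH; exists K.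
by apply: sum_bound_le hK => i; rewrite big_cons.
Qed.

Lemma csumD (I : choiceType) (a b : I -> R[i]) :
  abs_summable a -> abs_summable b ->
  csum (fun i => a i + b i) = csum a + csum b.
Proof. by move=> sa sb; apply/has_sum_csum/has_sumD; apply: csumP. Qed.

Lemma csumZ (I : choiceType) (a : I -> R[i]) c :
  abs_summable a -> csum (fun i => c * a i) = c * csum a.
Proof. by move=> sa; apply/has_sum_csum/has_sumZ/csumP. Qed.

Lemma csumB (I : choiceType) (a b : I -> R[i]) :
  abs_summable a -> abs_summable b ->
  csum (fun i => a i - b i) = csum a - csum b.
Proof.
move=> sa sb; rewrite -mulN1r -csumZ// -csumD//; last exact: abs_summableZ.
by congr csum; apply/funext => i; rewrite mulN1r.
Qed.

Lemma csum_bigsum (I : choiceType) (J : Type) (s : seq J) (a : J -> I -> R[i]) :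
  (forall j, abs_summable (a j)) ->
  csum (fun i => \sum_(j <- s) a j i) = \sum_(j <- s) csum (a j).
Proof.
move=> sa; elim: s => [|j s IH].
  rewrite big_nil; apply: has_sum_csum => e e0; exists fset0 => B _.
  by rewrite big1 ?subr0 ?normc0// => i _; rewrite big_nil.
rewrite big_cons -IH -csumD//; last exact: abs_summable_bigsum.
by congr csum; apply/funext => i; rewrite big_cons.
Qed.

Lemma big_fset_image (I J : choiceType) (phi : I -> J) (V : nmodType)
    (a : J -> V) (B : {fset I}) : injective phi ->
  \sum_(j <- [fset phi i | i in B]) a j = \sum_(i <- B) a (phi i).
Proof. by move=> iphi; rewrite big_imfset//= => x y _ _; apply: iphi. Qed.

Lemma sum_bound_inj (I J : choiceType) (phi : I -> J) (a : J -> R[i]) K :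
  injective phi -> sum_bound a K -> sum_bound (a \o phi) K.
Proof.
by move=> iphi aK B; rewrite -(big_fset_image (fun j => normc (a j)))// aK.
Qed.

Lemma abs_summable_inj (I J : choiceType) (phi : I -> J) (a : J -> R[i]) :
  injective phi -> abs_summable a -> abs_summable (a \o phi).
Proof. by move=> iphi [K aK]; exists K; apply: sum_bound_inj. Qed.

Lemma csum_support (I J : choiceType) (phi : I -> J) (a : J -> R[i]) :
  injective phi -> (forall j, (forall i, phi i <> j) -> a j = 0) ->
  abs_summable a -> csum a = csum (a \o phi).
Proof.
move=> iphi a0 sa; apply/esym.
apply: (has_sum_cofinal (csumP (abs_summable_inj iphi sa))) => A e e0.
have [AJ hA] := csumP sa e0.
(* A partial inverse of [phi]. Adding the preimages of [AJ] to [A] ensures that the indices by which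
   [AJ] exceeds the image of [B] lie outside the range of [phi], where [a] vanishes. *)
pose pre (j : J) : option I :=
  match pselect (exists i, phi i = j) with
  | left h => Some (projT1 (cid h)) | right _ => None end.
pose B := A `|` [fset i in pmap pre AJ]; exists B; first exact: fsubsetUl.
rewrite -(big_fset_image a)//.
set D := [fset phi i | i in B].
have -> : \sum_(j <- D) a j = \sum_(j <- D `|` AJ) a j.
  apply: big_fset_incl; first exact: fsubsetUl.
  move=> j; rewrite inE => /orP[->//|jA] jD; apply: a0 => i ij.
  move/negP: jD; apply; apply/imfsetP; exists i => //=; rewrite !inE.
  apply/orP; right; rewrite mem_pmap; apply/mapP; exists j => //.
  rewrite /pre; case: pselect => [h|[]]; last by exists i.
  by congr Some; apply: iphi; rewrite ij; case: cid.
exact: hA (fsubsetUr _ _).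
Qed.

Lemma csum_bij (I : choiceType) (phi psi : I -> I) (a : I -> R[i]) :
  cancel phi psi -> cancel psi phi -> abs_summable a ->
  csum (a \o phi) = csum a.
Proof.
move=> k1 k2 sa; rewrite -(@csum_support _ _ phi)//; first exact: can_inj k1.
by move=> j /(_ (psi j)) []; rewrite k2.
Qed.

Lemma big_fsetM (I J : choiceType) (V : pzSemiRingType) (a : I -> V) (b : J -> V)
    (A : {fset I}) (B : {fset J}) :
  \sum_(p <- A `*` B) a p.1 * b p.2 = (\sum_(i <- A) a i) * (\sum_(j <- B) b j).
Proof.
have -> : \sum_(p <- A `*` B) a p.1 * b p.2 =
    \sum_(p <- [seq (i, j) | i <- A, j <- B]) a p.1 * b p.2.
  apply: perm_big; apply: uniq_perm; first exact: fset_uniq.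
    by apply: allpairs_uniq; rewrite ?fset_uniq// => -[? ?] [].
  move=> [i j]; rewrite in_fsetM/=; apply/andP/allpairsP => [[iA jB]|].
    by exists (i, j).
  by move=> [[i' j'] /= [? ? [-> ->]]].
by rewrite big_allpairs big_distrlr.
Qed.

Lemma sum_bound_prod (I J : choiceType) (a : I -> R[i]) (b : J -> R[i]) K L :
  sum_bound a K -> sum_bound b L ->
  sum_bound (fun p : I * J => a p.1 * b p.2) (K * L).
Proof.
move=> aK bL D.
pose D1 := [fset p.1 | p in D]; pose D2 := [fset p.2 | p in D].
have DM : D `<=` D1 `*` D2.
  by apply/fsubsetP => p pD; rewrite in_fsetM; apply/andP; split;
    apply/imfsetP; exists p.
apply: (le_trans (sum_fset_le _ DM)) => [p|]; first exact: normc_ge0.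
under eq_bigr do rewrite normcM.
rewrite (big_fsetM (fun i => normc (a i)) (fun j => normc (b j))) ler_pM ?aK ?bL//;
  by apply: sumr_ge0 => *; apply: normc_ge0.
Qed.

Lemma abs_summable_prod (I J : choiceType) (a : I -> R[i]) (b : J -> R[i]) :
  abs_summable a -> abs_summable b ->
  abs_summable (fun p : I * J => a p.1 * b p.2).
Proof.
by move=> [K aK] [L bL]; exists (K * L); apply: sum_bound_prod.
Qed.

Lemma csum_prod (I J : choiceType) (a : I -> R[i]) (b : J -> R[i]) :
  abs_summable a -> abs_summable b ->
  csum (fun p : I * J => a p.1 * b p.2) = csum a * csum b.
Proof.
move=> sa sb; apply: (has_sum_cofinal (csumP (abs_summable_prod sa sb))).
move=> A e e0; set K := normc (csum a) + normc (csum b) + 1.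
have K0 : 0 < K by rewrite /K ltr_pwDr// addr_ge0 ?normc_ge0.
(* With both factors within [h <= 1] of their limits, the three error terms of the product add up to
   at most [h * K]. *)
pose h := Num.min 1 (e / (2 * K)).
have h0 : 0 < h by rewrite lt_min ltr01 divr_gt0// mulr_gt0.
have [A1 hA1] := csumP sa h0; have [A2 hA2] := csumP sb h0.
pose D1 := A1 `|` [fset p.1 | p in A]; pose D2 := A2 `|` [fset p.2 | p in A].
exists (D1 `*` D2).
  by apply/fsubsetP => p pA; rewrite in_fsetM !inE; apply/andP; split;
    apply/orP; right; apply/imfsetP; exists p.
rewrite (big_fsetM a b).
have := hA1 D1 (fsubsetUl _ _); have := hA2 D2 (fsubsetUl _ _).
set x := \sum_(i <- D1) _; set y := \sum_(i <- D2) _ => ny nx.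
have -> : x * y - csum a * csum b =
  (x - csum a) * (y - csum b) + (csum a * (y - csum b) + csum b * (x - csum a)).
  by ring.
have h1 : h <= 1 by rewrite ge_min lexx.
have he : h * K <= e / 2.
  have : h <= e / (2 * K) by rewrite ge_min lexx orbT.
  rewrite -(ler_pM2r K0) => /le_trans; apply.
  by rewrite invfM mulrA mulfVK// gt_eqF.
rewrite (le_lt_trans (le_normcD _ _))//.
have := le_normcD (csum a * (y - csum b)) (csum b * (x - csum a)).
rewrite !normcM => h2.
have a0 := normc_ge0 (csum a); have b0 := normc_ge0 (csum b).
have x0 := normc_ge0 (x - csum a); have y0 := normc_ge0 (y - csum b).
have m1 := ler_wpM2l a0 (ltW ny); have m2 := ler_wpM2l b0 (ltW nx).
have m3 : normc (x - csum a) * normc (y - csum b) <= 1 * h.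
  by apply: ler_pM => //; lra.
have : h * K = h * normc (csum a) + h * normc (csum b) + h by rewrite /K; ring.
move: m1 m2 m3 h2; rewrite mul1r ![_ * h]mulrC; lra.
Qed.

(** Each residue class is the image of an injection n -> j + L n, so [csum_support] applies to the
    restriction of [a] to it. *)
Lemma csum_residues (a : int -> R[i]) (L : nat) : (0 < L)%N -> abs_summable a ->
  csum a = \sum_(j < L) csum (fun n : int => a (j%:Z + L%:Z * n)).
Proof.
move=> L0 sa.
pose b (j : 'I_L) (m : int) := if (m %% L)%Z == j%:Z then a m else 0.
have sb j : abs_summable (b j).
  apply: abs_summable_le sa => m; rewrite /b; case: ifP => //.
  by rewrite normc0 normc_ge0.
have LZ : L%:Z != 0 by rewrite -lt0n.
transitivity (csum (fun m => \sum_(j < L) b j m)).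
  congr csum; apply/funext => m.
  have hm : (`|(m %% L)%Z|%N < L)%N.
    by rewrite -ltz_nat gez0_abs ?modz_ge0// ltz_pmod.
  rewrite (bigD1 (Ordinal hm))//= big1 ?addr0 => [|j jm].
    by rewrite /b /= gez0_abs ?modz_ge0// eqxx.
  rewrite /b; case: eqP => // mj; move/eqP: jm; case; apply/val_inj => /=.
  by rewrite mj.
rewrite csum_bigsum//; apply: eq_bigr => j _.
rewrite (@csum_support _ _ (fun n : int => j%:Z + L%:Z * n))//.
- congr csum; apply/funext => n; rewrite /b /=.
  by rewrite addrC mulrC modzMDl modz_nat modn_small ?eqxx.
- by move=> m n /addrI /(mulfI LZ).
- move=> m hm; rewrite /b; case: eqP => // mj; case: (hm (m %/ L)%Z).
  by rewrite [RHS](divz_eq m L) mj addrC mulrC.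
Qed.

Lemma csum_delta (I : choiceType) (i0 : I) (v : R[i]) :
  csum (fun i => if i == i0 then v else 0) = v.
Proof.
apply: has_sum_csum => e e0; exists [fset i0] => B.
rewrite fsub1set => iB; rewrite (big_fsetD1 i0)//= eqxx big_seq big1 ?addr0.
  by rewrite subrr normc0.
by move=> i; rewrite !inE => /andP[/negPf ->].
Qed.

Lemma abs_summable_delta (I : choiceType) (i0 : I) (v : R[i]) :
  abs_summable (fun i => if i == i0 then v else 0).
Proof.
exists (normc v) => B; case: (boolP (i0 \in B)) => [iB|iB].
  rewrite (big_fsetD1 i0)//= eqxx big_seq big1 ?addr0// => i.
  by rewrite !inE => /andP[/negPf ->]; rewrite normc0.
rewrite big_seq big1 ?normc_ge0// => i; case: eqP => [-> /(negP iB)//|_ _].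
exact: normc0.
Qed.

(** Tannery's theorem with limit 0: off a finite set [A] the dominating family sums to at most two
    thirds of [e], and on [A] the finitely many pointwise thresholds have a maximum. *)
Lemma csum_dominated (I : choiceType) (a : nat -> I -> R[i]) (D : I -> R) K :
  (forall B : {fset I}, \sum_(i <- B) D i <= K) ->
  (forall n i, normc (a n i) <= D i) ->
  (forall i (e : R), 0 < e -> exists n0, forall n, (n0 <= n)%N -> normc (a n i) <= e) ->
  forall e : R, 0 < e -> exists n0, forall n, (n0 <= n)%N -> normc (csum (a n)) <= e.
Proof.
move=> DK aD a0 e e0; have e3 : 0 < e / 3 by rewrite divr_gt0.
have D0 i : 0 <= D i by apply: le_trans (aD 0%N i); apply: normc_ge0.
have [l hl] := has_sum_real D0 DK; have [A hA] := hl _ e3.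
have tail (B : {fset I}) : A `<=` B -> \sum_(i <- B `\` A) D i <= e / 3 + e / 3.
  move=> AB; have h1 := hA A (fsubset_refl _); have h2 := hA B AB.
  have : normc ((\sum_(i <- B) D i)%:C%C - (\sum_(i <- A) D i)%:C%C) <= e / 3 + e / 3.
    rewrite !rmorph_sum /=.
    set x := \sum_(i <- B) _; set y := \sum_(i <- A) _.
    have -> : x - y = (x - l) - (y - l) by ring.
    rewrite (le_trans (le_normcD _ _))// normcN; move: h1 h2; rewrite -/x -/y; lra.
  rewrite -rmorphB normc_real (big_fsetID _ (mem A) B)/=.
  have -> : [fset x in B | x \in A] = A.
    apply/fsetP => x; rewrite !inE; case: (boolP (x \in A)) => [/(fsubsetP AB)->//|].
    by rewrite andbF.
  have -> : [fset x in B | x \notin A] = B `\` A.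
    by apply/fsetP => x; rewrite !inE andbC.
  by rewrite addrAC subrr add0r => /(le_trans (ler_norm _)).
have [n0 hn0] : exists n0, forall n, (n0 <= n)%N -> \sum_(i <- A) normc (a n i) <= e / 3.
  (* The extra 1 in the denominator covers an empty [A]. *)
  have c0 : 0 < e / 3 / (#|` A|%:R + 1) by rewrite divr_gt0// ltr_wpDl.
  have ch i := cid (a0 i _ c0).
  exists (\max_(i <- A) projT1 (ch i))%N => n hn.
  apply: (@le_trans _ _ (\sum_(i <- A) e / 3 / (#|` A|%:R + 1))).
    rewrite big_seq [leRHS]big_seq; apply: ler_sum => i iA.
    apply: (projT2 (ch i)); apply: leq_trans hn.
    exact: (@bigop.leq_bigmax_seq _ (enum_fset A) xpredT (fun i => projT1 (ch i)) i iA isT).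
  rewrite big_const_seq count_predT iter_addr addr0 -[leLHS]mulr_natr.
  have : e / 3 / (#|` A|%:R + 1) * (#|` A|%:R + 1) = e / 3.
    by rewrite mulfVK// gt_eqF// ltr_wpDl.
  by rewrite mulrDr mulr1 => h; rewrite -[leRHS]h lerDl ltW.
exists n0 => n /hn0 hn; apply: csum_norm_le => B.
apply: (@le_trans _ _ (\sum_(i <- A `|` B) normc (a n i))).
  by apply: sum_fset_le; [move=> i; exact: normc_ge0|exact: fsubsetUr].
rewrite (big_fsetID _ (mem A))/=.
have -> : [fset x in A `|` B | x \in A] = A.
  by apply/fsetP => x; rewrite !inE; case: (x \in A); rewrite ?andbF.
have -> : [fset x in A `|` B | x \notin A] = (A `|` B) `\` A.
  by apply/fsetP => x; rewrite !inE andbC.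
have : \sum_(i <- (A `|` B) `\` A) normc (a n i) <= e / 3 + e / 3.
  by apply: le_trans (tail _ (fsubsetUl A B)); apply: ler_sum.
lra.
Qed.

(** Serves to keep a theta series with nonnegative terms away from 0, by its term of index 0. *)
Lemma csum_Re_ge (I : choiceType) (a : I -> R[i]) (i0 : I) : abs_summable a ->
  (forall i, 0 <= complex.Re (a i)) -> complex.Re (a i0) <= complex.Re (csum a).
Proof.
move=> sa a0; apply/ler_addgt0Pr => e e0; have [A hA] := csumP sa e0.
have {hA} := hA _ (fsubsetUr [fset i0] A); set B := _ `|` A.
have := normc_Re (\sum_(i <- B) a i - csum a).
have -> : complex.Re (\sum_(i <- B) a i - csum a) =
    \sum_(i <- B) complex.Re (a i) - complex.Re (csum a).
  rewrite (raddfB (@complex.Re R : Rcomplex R -> R)); congr (_ - _).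
  by rewrite (raddf_sum (@complex.Re R : Rcomplex R -> R)).
have : complex.Re (a i0) <= \sum_(i <- B) complex.Re (a i).
  rewrite (big_fsetD1 i0) ?lerDl ?sumr_ge0//.
  by rewrite !inE eqxx.
set x := \sum_(i <- B) _; have := ler_norm (x - complex.Re (csum a)); lra.
Qed.

End unconditional_sum.

(** * The complex exponential *)

Section complex_exponential.
Variable R : realType.
Implicit Types z w : R[i].

Lemma cexpD z w : cexp (z + w) = cexp z * cexp w.
Proof.
case: z w => a b [c d]; rewrite /cexp/= expRD cosD sinD.
by apply/eqP; rewrite eq_complex /=; apply/andP; split; apply/eqP; ring.
Qed.

Lemma cexp0 : cexp 0 = 1 :> R[i].
Proof. by rewrite /cexp/= expR0 cos0 sin0 mul1r. Qed.

Lemma normc_cexp z : normc (cexp z) = expR (complex.Re z).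
Proof.
rewrite /cexp normcM normc_real ger0_norm ?expR_ge0//.
by rewrite /normc cos2Dsin2 sqrtr1 mulr1.
Qed.

Lemma cexp_neq0 z : cexp z != 0.
Proof.
apply/eqP => /(congr1 (@normc R)); rewrite normc_cexp normc0 => /eqP.
by rewrite expR_eq0.
Qed.

Lemma cexpN z : cexp (- z) = (cexp z)^-1.
Proof. by apply: (mulfI (cexp_neq0 z)); rewrite -cexpD subrr cexp0 divff ?cexp_neq0. Qed.

Lemma cexp_natM z n : cexp (n%:R * z) = cexp z ^+ n.
Proof.
elim: n => [|n IH]; first by rewrite mul0r cexp0 expr0.
by rewrite -natr1 mulrDl mul1r cexpD IH exprSr.
Qed.

Lemma cexp_intM z (n : int) : cexp (n%:~R * z) = cexp z ^ n.
Proof.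
case: n => n; first by rewrite -pmulrn cexp_natM.
by rewrite NegzE mulrNz mulNr cexpN -pmulrn cexp_natM -exprnN.
Qed.

Definition cpi : R[i] := (pi : R)%:C%C.

Lemma cexp_pii : cexp ('i%C * cpi) = -1.
Proof.
rewrite /cexp /cpi /= !(mul0r, mul1r, mulr0, subr0, addr0, add0r).
rewrite oppr0 expR0 cospi.
rewrite sinpi mul1r.
by apply/eqP; rewrite eq_complex /= oppr0 !eqxx.
Qed.

Lemma cexp_piiM (n : int) : cexp ('i%C * cpi * n%:~R) = (-1) ^ n.
Proof. by rewrite mulrC cexp_intM cexp_pii. Qed.

Lemma cexp_2pii (n : int) : cexp (2 * 'i%C * cpi * n%:~R) = 1.
Proof.
have -> : 2 * 'i%C * cpi * n%:~R = 'i%C * cpi * (2 * n)%:~R :> R[i].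
  by rewrite intrM; ring.
by rewrite cexp_piiM -exprz_exp -exprnP sqrrN expr1n exp1rz.
Qed.

(** The mean value theorem fails for complex values, so it is applied to the real function s -> Re
    (c (exp (s z) - s l)) on [0, 1]. Taking for [c] the conjugate of the quantity exp z - 1 - l to
    be bounded turns the left-hand side into its squared modulus. *)
Lemma cexp_mvt (c l z : R[i]) : exists2 x : R, 0 <= x <= 1 &
  complex.Re (c * (cexp z - l)) - complex.Re c =
  complex.Re (c * (z * cexp (x%:C%C * z) - l)).
Proof.
case: c l z => c1 c2 [l1 l2] [a b].
pose f (s : R) := c1 * (expR (s * a) * cos (s * b) - s * l1) -
                  c2 * (expR (s * a) * sin (s * b) - s * l2).
pose df (s : R) :=
  c1 * (a * (expR (s * a) * cos (s * b)) - b * (expR (s * a) * sin (s * b)) - l1) -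
  c2 * (b * (expR (s * a) * cos (s * b)) + a * (expR (s * a) * sin (s * b)) - l2).
have fdf (s : R) : is_derive s 1 f (df s).
  have lin c : is_derive s 1 (fun s : R => s * c) c.
    have -> : (fun s : R => s * c) = ( *:%R c).
      by apply/funext => y; rewrite mulrC.
    by apply: is_derive_eq; rewrite [LHS]mulr1.
  have e1 := @is_derive1_comp R expR ( *%R^~ a) s _ _ (is_derive_expR _) (lin a).
  have e2 := @is_derive1_comp R cos ( *%R^~ b) s _ _ (is_derive_cos _) (lin b).
  have e3 := @is_derive1_comp R sin ( *%R^~ b) s _ _ (is_derive_sin _) (lin b).
  have h1 := is_deriveB (is_deriveM e1 e2) (lin l1).
  have h2 := is_deriveB (is_deriveM e1 e3) (lin l2).
  have h := is_deriveB (is_deriveZ c1 h1) (is_deriveZ c2 h2).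
  apply: (is_derive_eq h); rewrite /df /GRing.scale/=; ring.
have [|x] := @MVT_segment R f df 0 1 ler01 (fun x _ => fdf x).
  by apply: derivable_within_continuous => x _; exact: (@ex_derive _ _ _ _ _ _ _ (fdf x)).
rewrite in_itv/= => x01; rewrite subr0 mulr1 => h; exists x => //.
transitivity (f 1 - f 0).
  by rewrite /f /cexp /= !mul1r !mul0r expR0 cos0 sin0; ring.
by rewrite h /df /cexp /= !mul0r !addr0 !subr0; ring.
Qed.

Lemma Re_conjM z : complex.Re (z^*%C * z) = normc z ^+ 2.
Proof.
case: z => a b; rewrite /normc sqr_sqrtr ?addr_ge0 ?sqr_ge0//= !expr2; ring.
Qed.

Lemma normc_conj z : normc (z^*%C) = normc z.
Proof. by case: z => a b; rewrite /normc/= sqrrN. Qed.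

(** The two endpoint values bound the whole segment. Multiplied by a Gaussian at y, this form of the
    bound becomes the sum of two Gaussians in [gauss_taylor]. *)
Lemma normc_cexp_scale (x : R) z : 0 <= x <= 1 ->
  normc (cexp (x%:C%C * z)) <= 1 + normc (cexp z).
Proof.
move=> /andP[x0 x1]; rewrite !normc_cexp.
have -> : complex.Re (x%:C%C * z) = x * complex.Re z.
  by case: z => a b /=; rewrite mul0r subr0.
have e0 := expR_ge0 (complex.Re z).
have [h|h] := leP 0 (complex.Re z).
  have : expR (x * complex.Re z) <= expR (complex.Re z).
    by rewrite ler_expR ler_piMl.
  lra.
have : expR (x * complex.Re z) <= 1.
  by rewrite expR_le1; apply: mulr_ge0_le0 => //; apply: ltW.
lra.
Qed.

Lemma normc_cexp_sub1 z :
  normc (cexp z - 1) <= normc z * (1 + normc (cexp z)).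
Proof.
set p := cexp z - 1; have [x x01] := cexp_mvt (p^*%C) 0 z.
rewrite !subr0 => h; have [->|p0] := eqVneq (normc p) 0.
  by rewrite mulr_ge0 ?addr_ge0 ?normc_ge0.
have pp : 0 < normc p by rewrite lt_def p0 normc_ge0.
have {}h : normc p ^+ 2 = complex.Re (p^*%C * (z * cexp (x%:C%C * z))).
  rewrite -h -Re_conjM /p; move: (p^*%C) (cexp z) => [a b] [c d] /=; ring.
rewrite -(ler_pM2l pp) -expr2 h (le_trans (ler_norm _))//.
rewrite (le_trans (normc_Re _))// normcM normc_conj ler_wpM2l ?normc_ge0//.
by rewrite normcM ler_wpM2l ?normc_ge0// normc_cexp_scale.
Qed.

Lemma normc_cexp_taylor2 z :
  normc (cexp z - 1 - z) <= normc z ^+ 2 * (2 * (1 + normc (cexp z))).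
Proof.
set p := cexp z - 1 - z; have [x x01 h] := cexp_mvt (p^*%C) z z.
have n1 := normc_ge0 (cexp z).
have [->|p0] := eqVneq (normc p) 0.
  by rewrite mulr_ge0 ?mulr_ge0 ?addr_ge0 ?exprn_ge0 ?normc_ge0.
have pp : 0 < normc p by rewrite lt_def p0 normc_ge0.
have {}h : normc p ^+ 2 = complex.Re (p^*%C * (z * (cexp (x%:C%C * z) - 1))).
  rewrite mulrBr mulr1 -h -Re_conjM.
  have E (c w l : R[i]) : complex.Re (c * (w - 1 - l)) =
      complex.Re (c * (w - l)) - complex.Re c.
    by case: c w l => [? ?] [? ?] [? ?] /=; ring.
  by rewrite {2}/p E.
rewrite -(ler_pM2l pp) -expr2 h (le_trans (ler_norm _))//.
rewrite (le_trans (normc_Re _))// normcM normc_conj ler_wpM2l ?normc_ge0//.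
rewrite normcM expr2 -mulrA ler_wpM2l ?normc_ge0//.
rewrite (le_trans (normc_cexp_sub1 _))// normcM normc_real.
have /andP[x0 x1] := x01.
rewrite ler_pM ?mulr_ge0 ?addr_ge0 ?normc_ge0//.
  by rewrite ger0_norm// ler_piMl ?normc_ge0.
by have := normc_cexp_scale z x01; lra.
Qed.

End complex_exponential.

(** * Riemann sums over (1/L)Z *)

Section lattice_averages.
Variable R : realType.
Local Open Scope fset_scope.
Local Open Scope ring_scope.

Lemma sum_bound_nat (u : nat -> R) K : (forall k, 0 <= u k) ->
  (forall n, \sum_(k < n) u k <= K) -> sum_bound (fun k => (u k)%:C%C) K.
Proof.
move=> u0 uK B.
have [n hn] : exists n, forall k, k \in B -> (k < n)%N.
  exists (\max_(k <- B) k).+1%N => k kB; rewrite ltnS.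
  exact: (@bigop.leq_bigmax_seq _ (enum_fset B) xpredT id k kB isT).
have BA : B `<=` [fset k in iota 0 n].
  by apply/fsubsetP => k kB; rewrite inE /= mem_iota /= hn.
under eq_bigr do rewrite normc_real ger0_norm//.
apply: (le_trans (sum_fset_le u0 BA)).
have -> : \sum_(k <- [fset k in iota 0 n]) u k = \sum_(k <- iota 0 n) u k.
  apply: perm_big; apply: uniq_perm; rewrite ?fset_uniq ?iota_uniq// => k.
  by rewrite !inE.
by have := uK n; rewrite -(big_mkord xpredT) /index_iota subn0.
Qed.

(** The integers embed into [bool * nat] by sign and absolute value, whence the factor 2. *)
Lemma sum_bound_int (u : nat -> R) K : (forall k, 0 <= u k) ->
  (forall n, \sum_(k < n) u k <= K) ->
  sum_bound (fun m : int => (u `|m|%N)%:C%C) (2 * K).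
Proof.
move=> u0 uK.
have b2 : sum_bound (fun _ : bool => 1 : R[i]) 2.
  move=> B; under eq_bigr do rewrite normc1.
  rewrite big_const_seq count_predT iter_addr addr0 ler_nat.
  apply: (@uniq_leq_size _ _ [:: true; false]); first exact: fset_uniq.
  by case; rewrite !inE.
have := sum_bound_prod b2 (sum_bound_nat u0 uK).
move=> /(@sum_bound_inj _ int _ (fun m : int => (0 <= m, `|m|%N))).
have ij : injective (fun m : int => (0 <= m, `|m|%N)).
  by move=> m n [h1 h2]; lia.
by move=> /(_ ij); apply: sum_bound_le => m; rewrite /= mul1r.
Qed.

Lemma geometric_bound (L : nat) : (0 < L)%N ->
  sum_bound (fun m : int => (expR (- `|m%:~R / L%:R|))%:C%C) (4 * L%:R : R).
Proof.
move=> L0; have LR : 0 < L%:R :> R by rewrite ltr0n.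
pose r := expR (- L%:R^-1) : R.
have r1 : r < 1 by rewrite expR_lt1 oppr_lt0 invr_gt0.
have r0 : 0 < r := expR_gt0 _.
(* From exp (1/L) >= 1 + 1/L follows r <= L/(L + 1), hence 1 - r >= 1/(L + 1) >= 1/(2L). *)
have rL : 1 <= (1 - r) * (2 * L%:R).
  have e1 : 1 + L%:R^-1 <= expR L%:R^-1 :> R by exact: expR_ge1Dx.
  have re : r * expR L%:R^-1 = 1 by rewrite /r mulrC expRxMexpNx_1.
  have : r * (1 + L%:R^-1) <= 1 by rewrite -[leRHS]re ler_pM2l.
  have wL : L%:R^-1 * L%:R = 1 :> R by rewrite mulVf// gt_eqF.
  have L1 : 1 <= L%:R :> R by rewrite ler1n.
  move=> /(ler_wpM2r (ltW LR)); rewrite mul1r => h1.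
  have h2 : r * (1 + L%:R^-1) * L%:R = r * L%:R + r.
    by rewrite mulrDr mulr1 mulrDl -mulrA wL mulr1.
  by rewrite h2 in h1; clearbody r; clear h2 wL e1 re; nra.
have := @sum_bound_int (fun k => r ^+ k) (2 * L%:R).
have -> : 2 * (2 * L%:R) = 4 * L%:R :> R by ring.
move=> h; apply: (sum_bound_le _ (h _ _)).
- move=> m; rewrite !normc_real (ger0_norm (expR_ge0 _)).
  rewrite (ger0_norm (exprn_ge0 _ (ltW r0))) /r -expRM_natl ler_expR normrM.
  rewrite (ger0_norm (_ : 0 <= L%:R^-1)) ?invr_ge0 ?ler0n//.
  by rewrite mulrN lerN2 -intr_norm natr_absz.
- by move=> k; rewrite exprn_ge0// ltW.
- move=> n; have d0 : 0 < 1 - r by lra.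
  rewrite -(ler_pM2l d0) (le_trans _ rL)//.
  have := subrX1 r n; have := exprn_ge0 n (ltW r0).
  set S := \sum_(i < n) _; nra.
Qed.

Definition exp_dominated (phi : R -> R[i]) (K : R) : Prop :=
  forall x, normc (phi x) <= K * expR (- `|x|).

(** The Riemann sum of mesh 1/L for the integral of [phi] over the real line; by [geometric_bound]
    it is bounded uniformly in L. *)
Definition avg (L : nat) (phi : R -> R[i]) : R[i] :=
  (L%:R^-1 : R)%:C%C * csum (fun m : int => phi (m%:~R / L%:R)).

Variable L : nat.
Hypothesis L0 : (0 < L)%N.

Lemma exp_dominated_summable phi K : exp_dominated phi K ->
  abs_summable (fun m : int => phi (m%:~R / L%:R)).
Proof.
move=> pK; have := abs_summableZ K%:C%C (ex_intro _ _ (geometric_bound L0)).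
apply: abs_summable_le => m; apply: (le_trans (pK _)).
by rewrite normcM !normc_real (ger0_norm (expR_ge0 _)) ler_wpM2r ?expR_ge0 ?ler_norm.
Qed.

Lemma avg_norm_le phi K : exp_dominated phi K -> normc (avg L phi) <= 4 * K.
Proof.
move=> pK; have LR : 0 < L%:R :> R by rewrite ltr0n.
have K0 : 0 <= K.
  by have := le_trans (normc_ge0 _) (pK 0); rewrite pmulr_lge0 ?expR_gt0.
rewrite /avg normcM normc_real (ger0_norm (_ : 0 <= _)) ?invr_ge0 ?ler0n//.
rewrite mulrC ler_pdivrMr//.
apply: csum_norm_le => B.
apply: (@le_trans _ _ (K * (4 * L%:R))); last by rewrite mulrCA mulrA.
apply: le_trans (ler_wpM2l K0 (geometric_bound L0 B)).
rewrite mulr_sumr; apply: ler_sum => m _; apply: (le_trans (pK _)).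
by rewrite normc_real (ger0_norm (expR_ge0 _)).
Qed.

Lemma avgD phi psi K K' : exp_dominated phi K -> exp_dominated psi K' ->
  avg L (fun x => phi x + psi x) = avg L phi + avg L psi.
Proof.
move=> h h'; rewrite /avg csumD ?mulrDr//.
  exact: exp_dominated_summable h.
exact: exp_dominated_summable h'.
Qed.

Lemma avgB phi psi K K' : exp_dominated phi K -> exp_dominated psi K' ->
  avg L (fun x => phi x - psi x) = avg L phi - avg L psi.
Proof.
move=> h h'; rewrite /avg csumB ?mulrBr//.
  exact: exp_dominated_summable h.
exact: exp_dominated_summable h'.
Qed.

Lemma avgZ phi c K : exp_dominated phi K ->
  avg L (fun x => c * phi x) = c * avg L phi.
Proof.
by move=> h; rewrite /avg csumZ 1?mulrCA//; apply: exp_dominated_summable h.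
Qed.

(** The discrete substitute for the vanishing of the integral of a derivative, and the source of
    summation by parts. Only shifts by multiples of the mesh are allowed. *)
Lemma avg_shift phi (n : int) K : exp_dominated phi K ->
  avg L (fun x => phi (x + n%:~R / L%:R)) = avg L phi.
Proof.
move=> h; rewrite /avg; congr (_ * _).
have := @csum_bij R int (fun m => m + n) (fun m => m - n) _ _ _ (exp_dominated_summable h).
move=> <-; [|exact: addrK|exact: subrK].
by congr csum; apply/funext => m /=; rewrite intrD mulrDl.
Qed.

End lattice_averages.

(** * Complex Gaussians: uniform decay and Taylor expansion *)

Section gaussian.
Variable R : realType.
Local Notation cpi := (@cpi R).

Definition gauss (y : R[i]) : R[i] := cexp (- cpi * y ^+ 2).

(** Equivalent to |arg s| < pi/4: [s] is then the principal square root of [s ^+ 2], which has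
    positive real part, and the Gaussian decays along every line of direction [s]. *)
Definition in_sector (s : R[i]) : Prop := `|complex.Im s| < complex.Re s.

Lemma normc_gauss y : normc (gauss y) = expR (- pi * complex.Re (y ^+ 2)).
Proof.
rewrite normc_cexp; congr expR; rewrite /cpi; move: (y ^+ 2) => [u v] /=.
by rewrite oppr0 mul0r subr0.
Qed.

Lemma gauss_dominated (k : nat) (a A : R) : 0 < a -> 0 <= A -> exists2 K : R,
  0 <= K & forall s b x, a <= complex.Re (s ^+ 2) -> normc s <= A -> normc b <= A ->
    (1 + `|x|) ^+ k * normc (gauss (s * x%:C%C + b)) <= K * expR (- `|x|).
Proof.
move=> a0 A0; have pi0 := pi_gt0 R.
(* [B] collects the coefficients of |x| to be absorbed by the quadratic term: k from (1 + |x|)^k <=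
   exp (k |x|), 1 from the target exp (-|x|), and 2 pi A^2 from the cross term of the square.
   Completing the square costs B^2 / (4 pi a). *)
pose B : R := k%:R + 1 + 2 * pi * A ^+ 2.
exists (expR (pi * A ^+ 2 + B ^+ 2 / (4 * pi * a))); first exact: expR_ge0.
move=> s b x ha hs hb; rewrite normc_gauss -expRD.
have h1 : (1 + `|x|) ^+ k <= expR (k%:R * `|x|).
  by rewrite expRM_natl lerXn2r ?nnegrE ?expR_ge0 ?addr_ge0// expR_ge1Dx.
apply: (le_trans (ler_wpM2r (expR_ge0 _) h1)); rewrite -expRD ler_expR.
have hq : a * `|x| ^+ 2 - 2 * A ^+ 2 * `|x| - A ^+ 2 <=
    complex.Re ((s * x%:C%C + b) ^+ 2).
  have -> : complex.Re ((s * x%:C%C + b) ^+ 2) = complex.Re (s ^+ 2) * x ^+ 2 +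
      2 * (complex.Re (s * b) * x) + complex.Re (b ^+ 2).
    case: s b {ha hs hb} => [s1 s2] [b1 b2]; rewrite !expr2 /=; ring.
  have r1 : complex.Re (s * b) * x >= - (A ^+ 2 * `|x|).
    rewrite lerNl (le_trans (ler_norm _))// normrN normrM ler_wpM2r//.
    rewrite (le_trans (normc_Re _))// normcM expr2.
    by apply: ler_pM => //; apply: normc_ge0.
  have r2 : complex.Re (b ^+ 2) >= - A ^+ 2.
    rewrite lerNl (le_trans (ler_norm _))// normrN.
    rewrite (le_trans (normc_Re _))// normcX lerXn2r ?nnegrE ?normc_ge0//.
  have r3 : a * x ^+ 2 <= complex.Re (s ^+ 2) * x ^+ 2.
    by rewrite ler_wpM2r ?sqr_ge0.
  have -> : `|x| ^+ 2 = x ^+ 2 by rewrite real_normK ?num_real.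
  lra.
have hsq : B * `|x| <= pi * a * `|x| ^+ 2 + B ^+ 2 / (4 * pi * a).
  have sq (c X D : R) : 0 < c -> D * X <= c * X ^+ 2 + D ^+ 2 / (4 * c).
    move=> c0; rewrite -subr_ge0.
    have -> : c * X ^+ 2 + D ^+ 2 / (4 * c) - D * X =
        (D - 2 * c * X) ^+ 2 / (4 * c) by field; rewrite gt_eqF.
    by rewrite divr_ge0 ?sqr_ge0// mulr_ge0// ltW.
  by rewrite -[4 * pi * a]mulrA; apply: sq; rewrite mulr_gt0.
have := ler_wpM2l (ltW pi0) hq.
move: hsq; rewrite /B; move: (complex.Re _) (_ / (4 * pi * a)) => u v.
lra.
Qed.

(** Second-order remainder of h -> (p + h p') gauss (y + h q). The derivative at 0 is symmetric in
    [p] and [q]; for this reason the same lemma, with the two exchanged, handles both the path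
    derivative and the x-derivative in [avg_gauss_line]. *)
Lemma gauss_taylor (p p' y q : R[i]) (h X : R) :
  1 <= X -> 0 <= h <= 1 ->
  normc p <= X -> normc p' <= X -> normc y <= X -> normc q <= X ->
  normc ((p + h%:C%C * p') * gauss (y + h%:C%C * q) - p * gauss y
         - h%:C%C * ((p' - 2 * cpi * p * q * y) * gauss y))
  <= h ^+ 2 * (18 * pi ^+ 2 + 4 * pi) * X ^+ 5 *
     (normc (gauss y) + normc (gauss (y + h%:C%C * q))).
Proof.
move=> X1 /andP[h0 h1] np np' ny nq.
have pi0 : 0 < pi :> R := pi_gt0 R.
have X0 : 0 <= X by lra.
have eqle (u v : R) : u = v -> u <= v by move->.
pose z := - (2 * cpi * h%:C%C * y * q) - cpi * h%:C%C ^+ 2 * q ^+ 2.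
have gz : gauss (y + h%:C%C * q) = gauss y * cexp z.
  by rewrite /gauss -cexpD; congr cexp; rewrite /z; ring.
rewrite gz; move EE : (cexp z) => E.
(* The three summands yield the constants 18 pi^2, pi and 3 pi. The power X^5 comes from the first:
   one factor X for [p] and (X^2)^2 for z^2. *)
have -> : (p + h%:C%C * p') * (gauss y * E) - p * gauss y -
    h%:C%C * ((p' - 2 * cpi * p * q * y) * gauss y) =
    gauss y * (p * (E - 1 - z) + (p * (- (cpi * h%:C%C ^+ 2 * q ^+ 2))
      + h%:C%C * p' * (E - 1))) by rewrite /z; ring.
have ncpi : normc cpi = pi by rewrite normc_real ger0_norm// ltW.
have nh : normc h%:C%C = h by rewrite normc_real ger0_norm.
have n2 : normc (2 : R[i]) = 2.
  have -> : 2 = (2 : R)%:C%C :> R[i] by rewrite rmorph_nat.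
  by rewrite normc_real ger0_norm.
have yq : normc y * normc q <= X ^+ 2 by rewrite expr2 ler_pM ?normc_ge0.
have qq : normc q ^+ 2 <= X ^+ 2 by rewrite lerXn2r ?nnegrE ?normc_ge0.
have hh : h ^+ 2 <= h by rewrite expr2 ler_piMl.
have nz : normc z <= 3 * pi * h * X ^+ 2.
  rewrite /z (le_trans (le_normcD _ _))// !normcN !(normcX, normcM) ncpi nh n2.
  have e1 : 2 * pi * h * (normc y * normc q) <= 2 * pi * h * X ^+ 2.
    by rewrite ler_wpM2l// !mulr_ge0// ltW.
  have e2 : pi * (h ^+ 2 * normc q ^+ 2) <= pi * (h * X ^+ 2).
    by rewrite ler_wpM2l ?(ltW pi0)// ler_pM ?exprn_ge0 ?normc_ge0.
  lra.
have e0 : 0 <= normc E := normc_ge0 _.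
have t1 : normc (E - 1) <= 3 * pi * h * X ^+ 2 * (1 + normc E).
  have := normc_cexp_sub1 z; rewrite EE => /le_trans; apply.
  by rewrite ler_wpM2r// addr_ge0.
have t2 : normc (E - 1 - z) <= (3 * pi * h * X ^+ 2) ^+ 2 * (2 * (1 + normc E)).
  have := normc_cexp_taylor2 z; rewrite EE => /le_trans; apply.
  rewrite ler_wpM2r ?mulr_ge0 ?addr_ge0//.
  by rewrite lerXn2r ?nnegrE ?normc_ge0 ?mulr_ge0 ?exprn_ge0// ltW.
have X35 : X ^+ 3 <= X ^+ 5 by rewrite ler_weXn2l.
have m1 : normc (p * (E - 1 - z)) <=
    h ^+ 2 * (18 * pi ^+ 2) * X ^+ 5 * (1 + normc E).
  rewrite normcM (le_trans (ler_pM (normc_ge0 _) (normc_ge0 _) np t2))//.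
  by apply: eqle; ring.
have m2 : normc (p * (- (cpi * h%:C%C ^+ 2 * q ^+ 2))) <=
    h ^+ 2 * pi * X ^+ 5 * (1 + normc E).
  rewrite normcM normcN !(normcX, normcM) ncpi nh.
  have e1 : normc p * normc q ^+ 2 <= X ^+ 3.
    by rewrite [X ^+ 3]exprS ler_pM ?exprn_ge0 ?normc_ge0.
  have e2 : normc p * normc q ^+ 2 <= X ^+ 5 * (1 + normc E).
    rewrite (le_trans e1)// (le_trans X35)// ler_peMr ?exprn_ge0// lerDl//.
  have c0 : 0 <= h ^+ 2 * pi by rewrite mulr_ge0 ?sqr_ge0 ?(ltW pi0).
  have e3 := ler_wpM2l c0 e2.
  rewrite -[leRHS](mulrA (h ^+ 2 * pi)). apply: le_trans e3; apply: eqle.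
  by move: (normc p) (normc q) (pi) => u v w; ring.
have m3 : normc (h%:C%C * p' * (E - 1)) <=
    h ^+ 2 * (3 * pi) * X ^+ 5 * (1 + normc E).
  rewrite !normcM nh.
  have e1 : normc p' * normc (E - 1) <= X * (3 * pi * h * X ^+ 2 * (1 + normc E)).
    by apply: ler_pM => //; apply: normc_ge0.
  have e2 : X ^+ 3 * (1 + normc E) <= X ^+ 5 * (1 + normc E).
    by rewrite ler_wpM2r// addr_ge0.
  have e3 := ler_wpM2l h0 e1.
  have : h ^+ 2 * (3 * pi) * (X ^+ 3 * (1 + normc E)) <=
      h ^+ 2 * (3 * pi) * (X ^+ 5 * (1 + normc E)).
    by rewrite ler_wpM2l// mulr_ge0 ?sqr_ge0// mulr_ge0// ltW.
  rewrite mulrA in e3; rewrite !mulrA in e3 *.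
  move=> e4; apply: (le_trans e3); apply: le_trans e4.
  by apply: eqle; ring.
rewrite normcM (normcM (gauss y) E).
have -> : normc (gauss y) + normc (gauss y) * normc E =
  normc (gauss y) * (1 + normc E) by ring.
rewrite [leRHS]mulrCA ler_wpM2l ?normc_ge0//.
rewrite (le_trans (le_normcD _ _))//.
have := le_normcD (p * (- (cpi * h%:C%C ^+ 2 * q ^+ 2))) (h%:C%C * p' * (E - 1)).
move=> m4.
have : h ^+ 2 * (18 * pi ^+ 2 + 4 * pi) * X ^+ 5 * (1 + normc E) =
  h ^+ 2 * (18 * pi ^+ 2) * X ^+ 5 * (1 + normc E) +
  (h ^+ 2 * pi * X ^+ 5 * (1 + normc E) + h ^+ 2 * (3 * pi) * X ^+ 5 * (1 + normc E)).
  by ring.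
lra.
Qed.

Lemma exp_dominatedZ (phi : R -> R[i]) c K :
  exp_dominated phi K -> exp_dominated (fun x => c * phi x) (normc c * K).
Proof. by move=> h x; rewrite normcM -mulrA ler_wpM2l ?normc_ge0. Qed.

Lemma exp_dominatedD (phi psi : R -> R[i]) K K' :
  exp_dominated phi K -> exp_dominated psi K' ->
  exp_dominated (fun x => phi x + psi x) (K + K').
Proof.
move=> h h' x; rewrite (le_trans (le_normcD _ _))// mulrDl.
exact: lerD.
Qed.

Lemma exp_dominatedB (phi psi : R -> R[i]) K K' :
  exp_dominated phi K -> exp_dominated psi K' ->
  exp_dominated (fun x => phi x - psi x) (K + K').
Proof.
move=> h h' x; rewrite (le_trans (le_normcD _ _))// normcN mulrDl.
exact: lerD.
Qed.

Lemma exp_dominated_shift (phi : R -> R[i]) c K : exp_dominated phi K ->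
  exp_dominated (fun x => phi (x + c)) (K * expR `|c|).
Proof.
move=> h x; apply: (le_trans (h _)).
have K0 : 0 <= K.
  by have := le_trans (normc_ge0 _) (h 0); rewrite pmulr_lge0 ?expR_gt0.
rewrite -mulrA ler_wpM2l// -expRD ler_expR.
have := ler_normD (x + c) (- c); rewrite addrK normrN; lra.
Qed.

End gaussian.

(** * Independence of the averages from the line *)

Section gaussian_line.
Variable R : realType.
Local Notation cpi := (@cpi R).

(* The derivative along the path (s, b) of s exp(-pi (s x + b)^2) is the x-derivative
   of an integrable function, so in the limit the averages do not depend on (s, b). *)
Lemma avg_gauss_line (s b : R[i]) : in_sector s -> exists K : R,
  forall L : nat, (0 < L)%N ->
  normc (avg L (fun x => s * gauss (s * x%:C%C + b)) -
         avg L (fun x => gauss x%:C%C)) <= K / L%:R.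
Proof.
move=> ss; have pi0 := pi_gt0 R.
(* Along the segment from 1 to [s] both Re + Im and Re - Im are convex combinations of 1 and a
   number at least [mu], so the real part of the square stays at least mu^2. *)
pose mu := Num.min 1 (complex.Re s - `|complex.Im s|).
have mu0 : 0 < mu by rewrite lt_min ltr01 subr_gt0.
have mu1 : mu <= 1 by rewrite ge_min lexx.
have mus : mu <= complex.Re s - `|complex.Im s| by rewrite ge_min lexx orbT.
pose A := 2 + 2 * normc s + 2 * normc b.
have ns := normc_ge0 s; have nb := normc_ge0 b.
have A1 : 1 <= A by rewrite /A; lra.
have A0 : 0 <= A by lra.
have [K K0 hK] := gauss_dominated 5 (exprn_gt0 2 mu0) A0.
pose C := (18 * pi ^+ 2 + 4 * pi) * A ^+ 5 * (K + K).
have W0 : 0 <= 18 * pi ^+ 2 + 4 * pi :> R.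
  by rewrite addr_ge0// mulr_ge0 ?exprn_ge0 ?(ltW pi0).
have C0 : 0 <= C.
  by apply: mulr_ge0; [apply: mulr_ge0; rewrite ?exprn_ge0|apply: addr_ge0].
exists (8 * C) => L L0; have LR : 0 < L%:R :> R by rewrite ltr0n.
have L1 : L%:R^-1 <= 1 :> R by rewrite invf_le1// ler1n.
have Li0 : 0 <= L%:R^-1 :> R by rewrite invr_ge0 ler0n.
(* The straight path from (1, 0) to (s, b). With [eta] the u-derivative of the argument of the
   Gaussian, [D u] is at once the u-derivative of [F u] and the x-derivative of [G u]. *)
pose sg (u : R) : R[i] := 1 + u%:C%C * (s - 1).
pose be (u : R) : R[i] := u%:C%C * b.
pose F u (x : R) := sg u * gauss (sg u * x%:C%C + be u).
pose eta (x : R) := (s - 1) * x%:C%C + b.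
pose G u (x : R) := eta x * gauss (sg u * x%:C%C + be u).
pose D u (x : R) := ((s - 1) - 2 * cpi * sg u * eta x * (sg u * x%:C%C + be u)) *
   gauss (sg u * x%:C%C + be u).
have sg_sq u : 0 <= u <= 1 -> mu ^+ 2 <= complex.Re (sg u ^+ 2).
  move=> /andP[u0 u1]; rewrite /sg; move: mus; case: (s) => p q /= hpq.
  have [q1 q2] : - (p - mu) <= q /\ q <= p - mu.
    by apply/andP; rewrite -ler_norml; lra.
  rewrite !expr2 /=.
  set v := (X in _ <= X).
  have -> : v = (1 + u * (p - 1) - u * q) * (1 + u * (p - 1) + u * q).
    by rewrite /v; ring.
  by apply: ler_pM; try lra; nra.
have nsg u : 0 <= u <= 1 -> normc (sg u) <= 1 + normc s.
  move=> /andP[u0 u1]; have -> : sg u = (1 - u)%:C%C + u%:C%C * s.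
    by rewrite /sg rmorphB rmorph1; ring.
  rewrite (le_trans (le_normcD _ _))// normcM !normc_real !ger0_norm//; last lra.
  nra.
have nbe u : 0 <= u <= 1 -> normc (be u) <= normc b.
  move=> /andP[u0 u1]; rewrite /be normcM normc_real ger0_norm//.
  by rewrite ler_piMl.
have ns1 : normc (s - 1) <= 1 + normc s.
  by rewrite (le_trans (le_normcD _ _))// normcN normc1 addrC.
have lin (c e : R[i]) (x : R) : normc c <= A -> normc e <= A ->
    normc (c * x%:C%C + e) <= A * (1 + `|x|).
  move=> hc he; rewrite (le_trans (le_normcD _ _))// normcM normc_real mulrDr mulr1.
  by rewrite addrC lerD// ler_wpM2r.
have AX (x : R) : 1 <= A * (1 + `|x|) by rewrite mulr_ege1// lerDl.
have hsA u : 0 <= u <= 1 -> normc (sg u) <= A by move=> /nsg; rewrite /A; lra.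
have hbA u : 0 <= u <= 1 -> normc (be u) <= A by move=> /nbe; rewrite /A; lra.
have hbsA u : 0 <= u <= 1 -> normc (be u + L%:R^-1%:C%C * sg u) <= A.
  move=> u01; rewrite (le_trans (le_normcD _ _))// (normcM _ (sg u)) normc_real ger0_norm//.
  have := ler_pM Li0 (normc_ge0 _) L1 (nsg _ u01); rewrite mul1r.
  by have := nbe _ u01; rewrite /A; lra.
have hsA1 : normc (s - 1) <= A by rewrite /A; lra.
have hbA1 : normc b <= A by rewrite /A; lra.
have AleX (x : R) : A <= A * (1 + `|x|) by rewrite ler_peMr// lerDl.
have X5 (x : R) : (A * (1 + `|x|)) ^+ 5 = A ^+ 5 * (1 + `|x|) ^+ 5 by rewrite exprMn.
have C5 (h g1 g2 x : R) : (1 + `|x|) ^+ 5 * g1 <= K * expR (- `|x|) ->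
    (1 + `|x|) ^+ 5 * g2 <= K * expR (- `|x|) ->
    h ^+ 2 * (18 * pi ^+ 2 + 4 * pi) * (A * (1 + `|x|)) ^+ 5 * (g1 + g2) <=
    h ^+ 2 * C * expR (- `|x|).
  move=> h1 h2; have := lerD h1 h2; rewrite -mulrDr -mulrDl X5 /C.
  have c0 : 0 <= h ^+ 2 * (18 * pi ^+ 2 + 4 * pi) * A ^+ 5.
    by rewrite mulr_ge0 ?exprn_ge0// mulr_ge0 ?sqr_ge0.
  move=> /(ler_wpM2l c0); move: (18 * pi ^+ 2 + 4 * pi) => c1.
  by rewrite !mulrA.
have E1 (u h : R) : 0 <= u <= 1 -> 0 <= h <= 1 -> 0 <= u + h <= 1 ->
    exp_dominated (fun x => F (u + h) x - F u x - h%:C%C * D u x) (h ^+ 2 * C).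
  move=> u01 h01 uh01 x.
  have := @gauss_taylor R (sg u) (s - 1) (sg u * x%:C%C + be u) (eta x) h
    (A * (1 + `|x|)) (AX x) h01.
  have e1 : sg u + h%:C%C * (s - 1) = sg (u + h) by rewrite /sg rmorphD/=; ring.
  have e2 : sg u * x%:C%C + be u + h%:C%C * eta x = sg (u + h) * x%:C%C + be (u + h).
    by rewrite /sg /be /eta rmorphD/=; ring.
  rewrite e1 e2 => H; apply: (le_trans (H _ _ _ _)).
  - exact: le_trans (hsA _ u01) (AleX x).
  - exact: le_trans hsA1 (AleX x).
  - by apply: lin; [apply: hsA|apply: hbA].
  - exact: lin.
  by apply: C5; apply: hK; rewrite ?sg_sq ?hsA ?hbA.
(* The increment is exactly the mesh 1/L, so the difference of [G u] averages to zero by [avg_shift]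
   and the average of [D u] is O(1/L). *)
have E2 (u : R) : 0 <= u <= 1 -> exp_dominated
    (fun x => G u (x + L%:R^-1) - G u x - L%:R^-1%:C%C * D u x) (L%:R^-1 ^+ 2 * C).
  move=> u01 x; have Li01 : 0 <= (L%:R^-1 : R) <= 1 by apply/andP.
  have := @gauss_taylor R (eta x) (s - 1) (sg u * x%:C%C + be u) (sg u) L%:R^-1
    (A * (1 + `|x|)) (AX x) Li01.
  have e1 : eta x + L%:R^-1%:C%C * (s - 1) = eta (x + L%:R^-1).
    by rewrite /eta rmorphD/=; ring.
  have e2 : sg u * x%:C%C + be u + L%:R^-1%:C%C * sg u =
      sg u * (x + L%:R^-1)%:C%C + be u by rewrite rmorphD/=; ring.
  have e3 : sg u * x%:C%C + be u + L%:R^-1%:C%C * sg u =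
      sg u * x%:C%C + (be u + L%:R^-1%:C%C * sg u) by ring.
  rewrite e1 => H.
  have -> : G u (x + L%:R^-1) - G u x - L%:R^-1%:C%C * D u x =
    eta (x + L%:R^-1) * gauss (sg u * x%:C%C + be u + L%:R^-1%:C%C * sg u)
    - eta x * gauss (sg u * x%:C%C + be u) - L%:R^-1%:C%C *
    ((s - 1 - 2 * cpi * eta x * sg u * (sg u * x%:C%C + be u)) *
       gauss (sg u * x%:C%C + be u)).
    by rewrite /G /D e2; ring.
  apply: (le_trans (H _ _ _ _)).
  - exact: lin.
  - exact: le_trans hsA1 (AleX x).
  - by apply: lin; [apply: hsA|apply: hbA].
  - exact: le_trans (hsA _ u01) (AleX x).
  apply: C5; last rewrite e3; apply: hK; rewrite ?sg_sq ?hsA ?hbA ?hbsA//.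
have domk (k : nat) u (x c : R) : 0 <= u <= 1 -> (k <= 5)%N -> 0 <= c ->
    c * (1 + `|x|) ^+ k * normc (gauss (sg u * x%:C%C + be u)) <=
    c * K * expR (- `|x|).
  move=> u01 k5 c0; rewrite -!mulrA ler_wpM2l//.
  apply: le_trans (hK (sg u) (be u) x _ _ _); rewrite ?sg_sq ?hsA ?hbA//.
  by rewrite ler_wpM2r ?normc_ge0// ler_weXn2l// lerDl.
have dF u : 0 <= u <= 1 -> exp_dominated (F u) (A * K).
  move=> u01 x; rewrite /F normcM; apply: le_trans (domk 0%N u x A u01 _ A0) => //.
  by rewrite expr0 mulr1 ler_wpM2r ?normc_ge0 ?hsA.
have dG u : 0 <= u <= 1 -> exp_dominated (G u) (A * K).
  move=> u01 x; rewrite /G normcM; apply: le_trans (domk 1%N u x A u01 _ A0) => //.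
  by rewrite expr1 ler_wpM2r ?normc_ge0 ?lin.
have dD u : 0 <= u <= 1 -> exp_dominated (D u) ((A + 2 * pi * A ^+ 3) * K).
  move=> u01 x; rewrite /D normcM.
  have c0 : 0 <= A + 2 * pi * A ^+ 3.
    by rewrite addr_ge0 ?mulr_ge0 ?exprn_ge0 ?(ltW pi0).
  apply: le_trans (domk 2%N u x _ u01 _ c0) => //.
  rewrite ler_wpM2r ?normc_ge0// (le_trans (le_normcD _ _))// normcN.
  have -> : normc (2 * cpi * sg u * eta x * (sg u * x%:C%C + be u)) =
      2 * pi * (normc (sg u) * (normc (eta x) * normc (sg u * x%:C%C + be u))).
    have -> : 2 * cpi = (2 * pi)%:C%C by rewrite rmorphM rmorph_nat.
    rewrite !(normcM, normc_real) ger0_norm ?mulr_ge0 ?(ltW pi0)//.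
    by rewrite -!mulrA.
  have X1 : 1 <= (1 + `|x|) ^+ 2 by rewrite exprn_ege1// lerDl.
  have t : normc (sg u) * (normc (eta x) * normc (sg u * x%:C%C + be u)) <=
      A * ((A * (1 + `|x|)) * (A * (1 + `|x|))).
    apply: ler_pM; rewrite ?mulr_ge0 ?normc_ge0 ?hsA//.
    by apply: ler_pM; rewrite ?normc_ge0// lin ?hsA ?hbA.
  have pp : 0 <= 2 * pi :> R by rewrite mulr_ge0 ?(ltW pi0).
  have := ler_wpM2l A0 X1; rewrite mulr1 => i1; have := ler_wpM2l pp t.
  have -> : 2 * pi * (A * (A * (1 + `|x|) * (A * (1 + `|x|)))) =
    2 * pi * A ^+ 3 * (1 + `|x|) ^+ 2 by ring.
  move=> i2; rewrite [leRHS](mulrDl A); apply: lerD => //.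
  exact: le_trans hsA1 i1.
have step (u h : R) : 0 <= u <= 1 -> 0 <= h <= 1 -> 0 <= u + h <= 1 ->
    normc (avg L (F (u + h)) - avg L (F u)) <= 4 * (h ^+ 2 * C) + h * (4 * (L%:R^-1 * C)).
  move=> u01 h01 uh01.
  have a1 := avg_norm_le L0 (E1 _ _ u01 h01 uh01).
  have a2 := avg_norm_le L0 (E2 _ u01).
  have dhD := exp_dominatedZ h%:C%C (dD _ u01).
  have dLD := exp_dominatedZ (L%:R^-1)%:C%C (dD _ u01).
  have dGs := exp_dominated_shift L%:R^-1 (dG _ u01).
  rewrite (avgB L0 (exp_dominatedB (dF _ uh01) (dF _ u01)) dhD) in a1.
  rewrite (avgB L0 (dF _ uh01) (dF _ u01)) (avgZ L0 _ (dD _ u01)) in a1.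
  rewrite (avgB L0 (exp_dominatedB dGs (dG _ u01)) dLD) in a2.
  rewrite (avgB L0 dGs (dG _ u01)) (avgZ L0 _ (dD _ u01)) in a2.
  have sh : avg L (fun x => G u (x + L%:R^-1)) = avg L (G u).
    by have := avg_shift L0 1 (dG _ u01); rewrite mul1r.
  rewrite sh subrr add0r normcN normcM normc_real (ger0_norm Li0) in a2.
  have {}a2 : normc (avg L (D u)) <= 4 * (L%:R^-1 * C).
    have := ler_wpM2l (ltW LR) a2; rewrite mulVKf ?gt_eqF//.
    have -> : L%:R * (4 * (L%:R^-1 ^+ 2 * C)) = 4 * (L%:R^-1 * C) * (L%:R * L%:R^-1) by ring.
    by rewrite divff ?gt_eqF// mulr1.
  have -> : avg L (F (u + h)) - avg L (F u) =
    (avg L (F (u + h)) - avg L (F u) - h%:C%C * avg L (D u)) + h%:C%C * avg L (D u) by ring.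
  rewrite (le_trans (le_normcD _ _))// lerD// normcM normc_real.
  have /andP[h0 h1] := h01.
  by rewrite ger0_norm// ler_wpM2l.
(* Each of the L steps of length 1/L costs 8 C / L^2, hence the total 8 C / L. *)
have steps k : (k <= L)%N ->
    normc (avg L (F (k%:R / L%:R)) - avg L (F 0)) <= k%:R * (8 * C * L%:R^-1 ^+ 2).
  elim: k => [|k IH] kL; first by rewrite !mul0r subrr normc0.
  have -> : avg L (F (k.+1%:R / L%:R)) - avg L (F 0) =
    (avg L (F (k%:R / L%:R + L%:R^-1)) - avg L (F (k%:R / L%:R))) +
    (avg L (F (k%:R / L%:R)) - avg L (F 0)).
    by rewrite -natr1 mulrDl mul1r; ring.
  have kk : k%:R / L%:R + L%:R^-1 = k.+1%:R / L%:R :> R by rewrite -natr1 mulrDl mul1r.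
  rewrite (le_trans (le_normcD _ _))//.
  have := step (k%:R / L%:R) L%:R^-1; rewrite kk.
  rewrite !divr_ge0 ?ler0n// !ler_pdivrMr// !mul1r !ler_nat kL (ltnW kL) Li0 L1.
  move=> /(_ isT isT isT); have := IH (ltnW kL).
  have -> : 4 * (L%:R^-1 ^+ 2 * C) + L%:R^-1 * (4 * (L%:R^-1 * C)) =
    8 * C * L%:R^-1 ^+ 2 :> R by ring.
  move=> i1 i2; rewrite -[X in _ <= X * _](natr1 k) [leRHS]mulrDl mul1r [leRHS]addrC.
  by apply: lerD.
have := steps L (leqnn L); rewrite divff ?gt_eqF//.
have -> : L%:R * (8 * C * L%:R^-1 ^+ 2) = 8 * C / L%:R.
  have -> : L%:R * (8 * C * L%:R^-1 ^+ 2) = 8 * C / L%:R * (L%:R / L%:R) by ring.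
  by rewrite divff ?gt_eqF// mulr1.
have -> : F 1 = fun x => s * gauss (s * x%:C%C + b).
  apply/funext => x; rewrite /F /sg /be rmorph1 !mul1r.
  by have -> : 1 + (s - 1) = s by ring.
have -> : F 0 = fun x => gauss x%:C%C.
  by apply/funext => x; rewrite /F /sg /be rmorph0 !mul0r !addr0 !mul1r.
by [].
Qed.

End gaussian_line.

(** * Poisson summation for complex Gaussians *)

Section fourier.
Variable R : realType.
Local Notation cpi := (@cpi R).

(** With u = 2v, monotonicity of sin v - v cos v gives sin u = 2 sin v cos v >= u (cos v)^2 = u (1 +
    cos u) / 2, and cos u >= 0. *)
Lemma sin_ge_half (u : R) : 0 <= u <= pi / 2 -> u / 2 <= sin u.
Proof.
move=> /andP[u0 u1]; have pi0 := pi_gt0 R.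
pose v := u / 2; have uv : u = v *+ 2 by rewrite /v -mulr_natr mulfVK.
have v0 : 0 <= v by rewrite divr_ge0.
have c1 : 0 <= cos u by apply: cos_ge0_pihalf; apply/andP; split => //; lra.
have c2 : 0 < cos v by apply: cos_gt0_pihalf; apply/andP; split; rewrite /v; lra.
have h : v * cos v <= sin v.
  pose f (x : R) := sin x - x * cos x.
  have df (x : R) : is_derive x 1 f (x * sin x).
    have := is_deriveB (is_derive_sin x) (is_deriveM (is_derive_id x (1 : R)) (is_derive_cos x)).
    by move=> /is_derive_eq; apply; rewrite /GRing.scale/=; ring.
  have [|x] := @MVT_segment R f (fun x => x * sin x) 0 v v0 (fun x _ => df x).
    by apply: derivable_within_continuous => x _; exact: (@ex_derive _ _ _ _ _ _ _ (df x)).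
  rewrite in_itv/= => /andP[x0 xv]; rewrite /f sin0 mul0r !subr0 => e.
  have : 0 <= x * sin x * v.
    rewrite !mulr_ge0// sin_ge0_pi// x0/= (le_trans xv)// /v; lra.
  by rewrite -e; lra.
have sq : cos u = cos v ^+ 2 *+ 2 - 1 by rewrite uv cos_mulr2n.
rewrite uv sin_mulr2n -uv -mulr_natr; rewrite -mulr_natr in sq.
have := ler_wpM2l (ltW c2) h; rewrite -/v; nra.
Qed.

Lemma cexp_root_neq1 (L j : nat) : (0 < j < L)%N ->
  cexp (- (2 * 'i%C * cpi) * (j%:R / L%:R : R)%:C%C) != 1.
Proof.
move=> /andP[j0 jL]; have L0 : 0 < L%:R :> R by rewrite ltr0n (leq_trans _ jL).
have pi0 := pi_gt0 R.
apply/eqP => h.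
have {h} : cos (- (pi * (j%:R / L%:R) *+ 2)) = 1 :> R.
  move/(congr1 (@complex.Re R)): h.
  rewrite /cexp (_ : - (2 * 'i%C * cpi) * (j%:R / L%:R : R)%:C%C =
    (0 +i* (- (pi * (j%:R / L%:R) *+ 2)))%C); last first.
    rewrite /cpi; apply/eqP; rewrite eq_complex /=; apply/andP; split; apply/eqP; ring.
  by rewrite /= expR0 mul1r mul0r subr0.
rewrite cosN cos_mulr2n => h.
have s0 : 0 < sin (pi * (j%:R / L%:R)) :> R.
  apply: sin_gt0_pi; apply/andP; split.
    by rewrite mulr_gt0// divr_gt0// ltr0n.
  by rewrite gtr_pMr// ltr_pdivrMr// mul1r ltr_nat.
have := cos2Dsin2 (pi * (j%:R / L%:R) : R); have := mulr_gt0 s0 s0.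
by rewrite mulr2n in h; rewrite -expr2; lra.
Qed.

(** The offset [K] permits the symmetric frequencies -K, ..., K of [csum_fourier] as well as, for K
    = 0, the divisibility test of [root_sum_int]. *)
Lemma root_sum (L j K : nat) : (j < L)%N ->
  \sum_(i < L) cexp (- (2 * 'i%C * cpi) * (i%:R - K%:R) * (j%:R / L%:R : R)%:C%C) =
  if j == 0%N then L%:R else 0.
Proof.
move=> jL; case: (posnP j) => [->|j0].
  rewrite (eq_bigr (fun=> 1)) ?sumr_const ?card_ord// => i _.
  by rewrite mul0r rmorph0 mulr0 cexp0.
set w := cexp (- (2 * 'i%C * cpi) * (j%:R / L%:R : R)%:C%C).
have w1 : w != 1 by apply: cexp_root_neq1; rewrite j0.
have wL : w ^+ L = 1.
  rewrite /w -cexp_natM.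
  have -> : L%:R * (- (2 * 'i%C * cpi) * (j%:R / L%:R : R)%:C%C) =
    - (2 * 'i%C * cpi * (j%:Z)%:~R).
    have LC : L%:R != 0 :> R[i] by rewrite pnatr_eq0 -lt0n (leq_trans _ jL).
    rewrite rmorphM fmorphV /= !rmorph_nat -pmulrn.
    have -> : L%:R * (- (2 * 'i%C * cpi) * (j%:R / L%:R)) =
      - (2 * 'i%C * cpi * j%:R) * (L%:R / L%:R) by ring.
    by rewrite divff// mulr1.
  by rewrite cexpN cexp_2pii invr1.
have -> : \sum_(i < L) cexp (- (2 * 'i%C * cpi) * (i%:R - K%:R) * (j%:R / L%:R : R)%:C%C) =
    (w ^+ K)^-1 * \sum_(i < L) w ^+ i.
  rewrite mulr_sumr; apply: eq_bigr => i _.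
  rewrite /w -!cexp_natM -cexpN -cexpD; congr cexp; ring.
have := subrX1 w L; rewrite wL subrr => /esym/eqP; rewrite mulf_eq0 subr_eq0.
by rewrite (negPf w1) => /eqP ->; rewrite mulr0.
Qed.

Definition char (n x : R[i]) : R[i] := cexp (- (2 * 'i%C * cpi) * n * x).

Lemma normc_char (n x : R) : normc (char n%:C%C x%:C%C) = 1.
Proof.
rewrite /char normc_cexp /cpi -[RHS]expR0; congr expR => /=; ring.
Qed.

Lemma intC (n : int) : (n%:~R : R)%:C%C = n%:~R.
Proof. exact: rmorph_int. Qed.

(* Fourier inversion on Z/LZ applied to j |-> sum_k phi(k + j/L). *)
Lemma csum_fourier (phi : R -> R[i]) C (K : nat) : exp_dominated phi C ->
  csum (fun n : int => phi n%:~R) =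
  \sum_(i < K.*2.+1) avg K.*2.+1 (fun x => phi x * char (i%:R - K%:R) x%:C%C).
Proof.
move=> dphi; set L := K.*2.+1.
have L0 : (0 < L)%N by [].
have LR : L%:R != 0 :> R by rewrite pnatr_eq0.
have nc (i : 'I_L) (x : R) : normc (char (i%:R - K%:R) x%:C%C) = 1.
  by rewrite (_ : i%:R - K%:R = (i%:R - K%:R)%:C%C) ?normc_char// rmorphB !rmorph_nat.
have dchar (i : 'I_L) : exp_dominated (fun x => phi x * char (i%:R - K%:R) x%:C%C) C.
  by move=> x; rewrite normcM nc mulr1.
pose h (j : nat) := csum (fun k : int => phi (j%:R / L%:R + k%:~R)).
(* The frequency is an integer, so the character depends only on the residue j and factors out of
   the sum over each class. After exchanging sums, orthogonality of characters leaves j = 0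
   alone. *)
have step (i : 'I_L) : avg L (fun x => phi x * char (i%:R - K%:R) x%:C%C) =
    (L%:R^-1 : R)%:C%C *
    \sum_(j < L) char (i%:R - K%:R) (j%:R / L%:R : R)%:C%C * h j.
  rewrite /avg (csum_residues L0 (exp_dominated_summable L0 (dchar i))).
  congr (_ * _); apply: eq_bigr => j _; rewrite /h -csumZ; last first.
    have := exp_dominated_summable (isT : (0 < 1)%N) (exp_dominated_shift (j%:R / L%:R) dphi).
    by apply: abs_summable_le => k; rewrite divr1 addrC.
  congr csum; apply/funext => k.
  have -> : (j%:Z + L%:Z * k)%:~R / L%:R = j%:R / L%:R + k%:~R :> R.
    by rewrite intrD intrM -!pmulrn mulrDl mulrAC divff// mul1r.
  rewrite mulrC; congr (_ * _).
  rewrite /char rmorphD mulrDr cexpD [X in _ * X](_ : _ = 1) ?mulr1//.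
  rewrite /= intC.
  have -> : - (2 * 'i%C * cpi) * (i%:R - K%:R) * k%:~R =
      2 * 'i%C * cpi * ((K%:Z - i%:Z) * k)%:~R.
    by rewrite intrM intrD mulrNz -!pmulrn; ring.
  exact: cexp_2pii.
rewrite (eq_bigr _ (fun i _ => step i)) -mulr_sumr exchange_big /=.
rewrite (eq_bigr (fun j : 'I_L => (if val j == 0%N then L%:R else 0) * h j)); last first.
  by move=> j _; rewrite -mulr_suml root_sum.
rewrite (bigD1 ord0)//= big1 ?addr0 => [|j j0]; last first.
  by rewrite ifF ?mul0r//; apply/eqP => j00; move/eqP: j0; apply; apply/val_inj.
rewrite mulrA -(rmorph_nat (real_complex R) L) -rmorphM/= mulVf// mul1r.
by congr csum; apply/funext => k; rewrite mul0r add0r.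
Qed.

End fourier.

(** * Theta series and decay of their discrete Fourier coefficients *)

Section poisson.
Variable R : realType.
Local Notation cpi := (@cpi R).

Lemma sector_Re (s : R[i]) : in_sector s -> 0 < complex.Re (s ^+ 2).
Proof.
case: s => p q; rewrite /in_sector /= ltr_norml => /andP[h1 h2].
by nra.
Qed.

Lemma sector_sqrt (l : R[i]) : 0 < complex.Re l ->
  exists2 s, in_sector s & s ^+ 2 = l.
Proof.
move=> l0; case E : (sqrtc l) => [p q].
have e : (p +i* q)%C ^+ 2 = l by rewrite -E sqr_sqrtc.
have h : q ^+ 2 < p ^+ 2.
  by move: l0; rewrite -e expr2 /= -!expr2 subr_gt0.
have h2 : `|q| < `|p| by rewrite -ltr_sqr ?nnegrE// !real_normK ?num_real.
have [p0|p0] := leP 0 p.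
  by exists (p +i* q)%C => //; rewrite /in_sector /= -(ger0_norm p0).
exists (- (p +i* q)%C); last by rewrite sqrrN.
by rewrite /in_sector /= normrN -(ltr0_norm p0).
Qed.

Lemma sector_neq0 (s : R[i]) : in_sector s -> s != 0.
Proof.
move=> ss; apply/eqP => s0; have := sector_Re ss.
by rewrite s0 expr0n /= ltxx.
Qed.

Lemma Re_inv (l : R[i]) :
  complex.Re l^-1 = complex.Re l / normc l ^+ 2.
Proof.
case: l => a b; rewrite /normc sqr_sqrtr ?addr_ge0 ?sqr_ge0//=.
Qed.

Lemma Re_inv_gt0 (l : R[i]) : 0 < complex.Re l -> 0 < complex.Re l^-1.
Proof.
move=> l0; rewrite Re_inv divr_gt0// exprn_gt0// lt_def normc_ge0 andbT.
by apply/eqP => /eq0_normc l00; move: l0; rewrite l00 ltxx.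
Qed.

Lemma in_sectorV (s : R[i]) : in_sector s -> in_sector s^-1.
Proof.
move=> ss; have s0 := sector_neq0 ss.
have n0 : 0 < normc s by rewrite lt_def normc_ge0 andbT; apply: contra s0 => /eqP/eq0_normc ->.
move: ss n0; case: s {s0} => p q; rewrite /in_sector /normc /= => h n0.
have d0 : 0 < p ^+ 2 + q ^+ 2 by move: n0; rewrite sqrtr_gt0.
rewrite normrN normrM (ger0_norm (_ : 0 <= (p ^+ 2 + q ^+ 2)^-1)) ?invr_ge0 ?(ltW d0)//.
by rewrite ltr_pM2r ?invr_gt0.
Qed.

Definition Theta (l : R[i]) (al : R) : R[i] :=
  csum (fun n : int => cexp (- cpi * l * (n%:~R + al%:C%C) ^+ 2)).

Definition Psi_term (l : R[i]) (al : R) (n : int) : R[i] :=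
  cexp (- cpi * l * n%:~R ^+ 2 + 2 * 'i%C * cpi * n%:~R * al%:C%C).

Definition Psi (l : R[i]) (al : R) : R[i] := csum (Psi_term l al).

Lemma theta_dominated (l : R[i]) : 0 < complex.Re l -> exists K,
  exp_dominated (fun x : R => cexp (- cpi * l * x%:C%C ^+ 2)) K.
Proof.
move=> l0; have [s ss sl] := sector_sqrt l0.
have [K _ hK] := gauss_dominated 0 (sector_Re ss) (normc_ge0 s).
exists K => x; have := hK s 0 x (lexx _) (lexx _).
rewrite normc0 normc_ge0 => /(_ isT); rewrite expr0 mul1r addr0.
by rewrite /gauss exprMn sl mulrA.
Qed.

Lemma theta_summable (l : R[i]) al : 0 < complex.Re l ->
  abs_summable (fun n : int => cexp (- cpi * l * (n%:~R + al%:C%C) ^+ 2)).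
Proof.
move=> /theta_dominated[K /(exp_dominated_shift al) hK].
have := exp_dominated_summable (isT : (0 < 1)%N) hK.
by apply: abs_summable_le => n; rewrite divr1 rmorphD /= intC.
Qed.

Lemma Psi_term_norm (l : R[i]) al (n : int) :
  normc (Psi_term l al n) = expR (- (pi * complex.Re l * n%:~R ^+ 2)).
Proof.
rewrite /Psi_term normc_cexp -intC -rmorphXn /= /cpi.
by case: l => a b /=; congr expR; ring.
Qed.

Lemma Psi_summable (l : R[i]) al : 0 < complex.Re l -> abs_summable (Psi_term l al).
Proof.
move=> /(theta_summable 0); apply: abs_summable_le => n.
rewrite Psi_term_norm normc_cexp -intC -rmorphD -rmorphXn /= /cpi addr0.
by case: l => a b /=; rewrite ler_expR; lra.
Qed.

(** The second difference of the Gaussian with step h = 1/L is O(h^2); moved onto the character it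
    becomes the factor -4 sin^2 (pi n / L). The restriction |n| <= K keeps pi |n| / L below pi/2,
    where the sine is bounded below linearly. The bound is uniform in K, as domination requires. *)
Lemma avg_fourier_decay (s : R[i]) (al : R) : in_sector s -> exists2 B : R, 0 <= B &
  forall (K : nat) (n : int), (`|n| <= K)%N ->
  normc (avg K.*2.+1 (fun x => gauss (s * x%:C%C + s * al%:C%C) *
     char n%:~R x%:C%C)) * (1 + n%:~R ^+ 2) <= B.
Proof.
move=> ss; have a0 := sector_Re ss; have pi0 := pi_gt0 R.
pose A := 1 + 2 * normc s + normc (s * al%:C%C).
have ns := normc_ge0 s; have nsa := normc_ge0 (s * al%:C%C).
have A0 : 0 <= A by rewrite /A; lra.
have A1 : 1 <= A by rewrite /A; lra.
have [C C0 hC] := gauss_dominated 5 a0 A0.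
pose W : R := 18 * pi ^+ 2 + 4 * pi.
have W0 : 0 <= W by rewrite addr_ge0// mulr_ge0 ?exprn_ge0 ?(ltW pi0).
pose C2 := W * A ^+ 5 * (C + C).
have C20 : 0 <= C2.
  by apply: mulr_ge0; [apply: mulr_ge0; rewrite ?exprn_ge0|apply: addr_ge0].
exists (2 * C2 + 4 * C); first by rewrite addr_ge0// mulr_ge0.
move=> K n nK; set L := K.*2.+1; have L0 : (0 < L)%N by [].
have LR : 0 < L%:R :> R by rewrite ltr0n.
pose h : R := L%:R^-1.
have h0 : 0 < h by rewrite invr_gt0.
have h1 : h <= 1 by rewrite invf_le1// ler1n.
pose phi (x : R) := gauss (s * x%:C%C + s * al%:C%C).
have dphi : exp_dominated phi C.
  move=> x; apply: le_trans (hC s (s * al%:C%C) x _ _ _); rewrite /A; try lra.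
  by rewrite ler_peMl ?normc_ge0// exprn_ege1// lerDl.
have nch (x : R) : normc (char n%:~R x%:C%C) = 1 by rewrite -intC normc_char.
pose psi (x : R) := phi x * char n%:~R x%:C%C.
have dpsi : exp_dominated psi C by move=> x; rewrite normcM nch mulr1.
have chD (x y : R) : char n%:~R (x + y)%:C%C = char n%:~R x%:C%C * char n%:~R y%:C%C.
  by rewrite /char rmorphD mulrDr cexpD.
have lin (x : R) : normc (s * x%:C%C + s * al%:C%C) <= A * (1 + `|x|).
  rewrite (le_trans (le_normcD _ _))// normcM normc_real.
  have : normc s * `|x| <= A * `|x| by rewrite ler_wpM2r// /A; lra.
  by rewrite mulrDr mulr1 /A; lra.
have AX (x : R) : A <= A * (1 + `|x|) by rewrite ler_peMr// lerDl.
(* [gauss_taylor] with p = 1, p' = 0 and q = e s; it is used for e = 1 and e = -1, whose first-order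
   terms cancel in the second difference [Dl]. *)
have T (e : R[i]) (x : R) : normc e = 1 ->
    normc (phi x) * (1 + `|x|) ^+ 5 <= C * expR (- `|x|) ->
    normc (gauss (s * x%:C%C + s * al%:C%C + h%:C%C * (e * s))) * (1 + `|x|) ^+ 5
      <= C * expR (- `|x|) ->
    normc (gauss (s * x%:C%C + s * al%:C%C + h%:C%C * (e * s)) - phi x
      + h%:C%C * (2 * cpi * (e * s) * (s * x%:C%C + s * al%:C%C) * phi x))
    <= h ^+ 2 * C2 * expR (- `|x|).
  move=> e1 g1 g2.
  have h01 : 0 <= h <= 1 by rewrite h1 ltW.
  have := @gauss_taylor R 1 0 (s * x%:C%C + s * al%:C%C) (e * s) h
    (A * (1 + `|x|)) (le_trans A1 (AX x)) h01.
  rewrite normc1 normc0 normcM e1 mul1r lin (le_trans A1 (AX x)).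
  rewrite (le_trans _ (AX x)) ?(le_trans ler01 A1)// => /(_ isT isT isT).
  rewrite (le_trans _ (AX x)); last by rewrite /A; lra.
  move=> /(_ isT); rewrite -/W -/(phi x).
  rewrite mulr0 addr0 !mul1r mulr1 sub0r => H.
  have -> : gauss (s * x%:C%C + s * al%:C%C + h%:C%C * (e * s)) - phi x
      + h%:C%C * (2 * cpi * (e * s) * (s * x%:C%C + s * al%:C%C) * phi x) =
    gauss (s * x%:C%C + s * al%:C%C + h%:C%C * (e * s)) - phi x -
      h%:C%C * (- (2 * cpi * (e * s) * (s * x%:C%C + s * al%:C%C)) * phi x) by ring.
  apply: (le_trans H); have := lerD g1 g2.
  have c0 : 0 <= h ^+ 2 * W * A ^+ 5.
    by apply: mulr_ge0; [apply: mulr_ge0; rewrite ?sqr_ge0|rewrite exprn_ge0].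
  move=> /(ler_wpM2l c0); rewrite exprMn /C2.
  set g := normc (gauss _); clearbody W; move: (expR _) => E.
  move=> H2; have -> : h ^+ 2 * W * (A ^+ 5 * (1 + `|x|) ^+ 5) * (normc (phi x) + g) =
    h ^+ 2 * W * A ^+ 5 * (normc (phi x) * (1 + `|x|) ^+ 5 + g * (1 + `|x|) ^+ 5) by ring.
  apply: (le_trans H2); rewrite le_eqVlt; apply/orP; left; apply/eqP; ring.
pose Dl (x : R) := phi (x + h) + phi (x - h) - 2 * phi x.
have hs : normc (h%:C%C * s) <= normc s.
  by rewrite normcM normc_real (ger0_norm (ltW h0)) ler_piMl ?normc_ge0.
have dDl : exp_dominated Dl (h ^+ 2 * (2 * C2)).
  move=> x.
  have e1 : s * x%:C%C + s * al%:C%C + h%:C%C * (1 * s) =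
      s * x%:C%C + (s * al%:C%C + h%:C%C * s) by ring.
  have e2 : s * x%:C%C + s * al%:C%C + h%:C%C * ((-1) * s) =
      s * x%:C%C + (s * al%:C%C - h%:C%C * s) by ring.
  have b1 : normc (s * al%:C%C + h%:C%C * s) <= A.
    by rewrite (le_trans (le_normcD _ _))// /A; lra.
  have b2 : normc (s * al%:C%C - h%:C%C * s) <= A.
    by rewrite (le_trans (le_normcD _ _))// normcN /A; lra.
  have sA : normc s <= A by rewrite /A; lra.
  have bA : normc (s * al%:C%C) <= A by rewrite /A; lra.
  have g0 : normc (phi x) * (1 + `|x|) ^+ 5 <= C * expR (- `|x|).
    by rewrite mulrC; apply: hC.
  have := T 1 x; rewrite e1 normc1 => /(_ erefl g0) t1.
  have := T (-1) x; rewrite e2 normcN normc1 => /(_ erefl g0) t2.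
  have {}t1 := t1 _; have {}t2 := t2 _.
  have g1 : normc (gauss (s * x%:C%C + (s * al%:C%C + h%:C%C * s))) *
    (1 + `|x|) ^+ 5 <= C * expR (- `|x|) by rewrite mulrC; apply: hC.
  have g2 : normc (gauss (s * x%:C%C + (s * al%:C%C - h%:C%C * s))) *
    (1 + `|x|) ^+ 5 <= C * expR (- `|x|) by rewrite mulrC; apply: hC.
  have := lerD (t1 g1) (t2 g2); set u := (X in normc X + _); set v := (X in _ + normc X).
  have -> : Dl x = u + v.
    rewrite /u /v /Dl -/(phi x).
    have -> : phi (x + h) = gauss (s * x%:C%C + (s * al%:C%C + h%:C%C * s)).
      by rewrite /phi; congr gauss; rewrite rmorphD /=; ring.
    have -> : phi (x - h) = gauss (s * x%:C%C + (s * al%:C%C - h%:C%C * s)).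
      by rewrite /phi; congr gauss; rewrite rmorphB /=; ring.
    ring.
  move=> uv; apply: (le_trans (le_normcD _ _)); apply: (le_trans uv).
  by rewrite le_eqVlt; apply/orP; left; apply/eqP; ring.
have dDlc : exp_dominated (fun x => Dl x * char n%:~R x%:C%C) (h ^+ 2 * (2 * C2)).
  by move=> x; rewrite normcM nch mulr1.
(* Summation by parts: the shifts by h and -h are undone by [avg_shift], at the price of character
   values. *)
have key : avg L (fun x => Dl x * char n%:~R x%:C%C) =
    (char n%:~R h%:C%C + char n%:~R (- h)%:C%C - 2) * avg L psi.
  have -> : (fun x => Dl x * char n%:~R x%:C%C) = (fun x =>
    (char n%:~R (- h)%:C%C * psi (x + h) + char n%:~R h%:C%C * psi (x - h)) - 2 * psi x).
    apply/funext => x; rewrite /Dl /psi.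
    have e1 : char n%:~R (- h)%:C%C * char n%:~R (x + h)%:C%C = char n%:~R x%:C%C.
      by rewrite -chD; congr (char _ _%:C%C); ring.
    have e2 : char n%:~R h%:C%C * char n%:~R (x - h)%:C%C = char n%:~R x%:C%C.
      by rewrite -chD; congr (char _ _%:C%C); ring.
    rewrite (mulrCA _ (phi (x + h))) e1 (mulrCA _ (phi (x - h))) e2; ring.
  have d1 := exp_dominatedZ (char n%:~R (- h)%:C%C) (exp_dominated_shift h dpsi).
  have d2 := exp_dominatedZ (char n%:~R h%:C%C) (exp_dominated_shift (- h) dpsi).
  have d12 := exp_dominatedD d1 d2.
  rewrite (avgB L0 d12 (exp_dominatedZ 2 dpsi)) (avgD L0 d1 d2).
  rewrite (avgZ L0 _ (exp_dominated_shift h dpsi)).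
  rewrite (avgZ L0 _ (exp_dominated_shift (- h) dpsi)) (avgZ L0 _ dpsi).
  have := avg_shift L0 1 dpsi; rewrite mul1r => ->.
  have := avg_shift L0 (-1) dpsi; rewrite mulrN1z mulN1r => ->.
  ring.
have small := avg_norm_le L0 dDlc; rewrite key normcM in small.
pose u := pi * (`|n|%:R * h).
have n0 : 0 <= (`|n|%:R : R) by rewrite ler0n.
have u01 : 0 <= u <= pi / 2.
  have nL : `|n|%:R * 2 <= L%:R :> R.
    by rewrite -natrM ler_nat /L -muln2 ltnW// ltnS leq_mul2r nK orbT.
  apply/andP; split; first by rewrite /u mulr_ge0 ?(ltW pi0)// mulr_ge0// ltW.
  rewrite /u ler_pM2l// /h ler_pdivrMr//; lra.
have cosE : char n%:~R h%:C%C + char n%:~R (- h)%:C%C - 2 = (- (4 * sin u ^+ 2))%:C%C.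
  have ch (y : R) : char n%:~R y%:C%C =
      (cos (2 * pi * n%:~R * y) -i* sin (2 * pi * n%:~R * y))%C.
    rewrite /char -intC /cexp /cpi.
    rewrite (_ : - (2 * 'i%C * pi%:C%C) * n%:~R%:C%C * y%:C%C =
      (0 +i* (- (2 * pi * n%:~R * y)))%C); last first.
      apply/eqP; rewrite eq_complex /=; apply/andP; split; apply/eqP; ring.
    by rewrite /= expR0 mul1r cosN sinN.
  rewrite !ch mulrN cosN sinN.
  have -> : cos (2 * pi * n%:~R * h) = cos (u *+ 2).
    rewrite -cos_norm !normrM (ger0_norm (ltW pi0)) (ger0_norm (ltW h0)).
    rewrite (ger0_norm (_ : (0 : R) <= 2))// -intr_norm -natr_absz -mulr_natl /u.
    by congr cos; ring.
  rewrite cos_mulr2n.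
  have := cos2Dsin2 u; move: (sin (2 * pi * n%:~R * h)) (cos u) (sin u) => w c e ce.
  apply/eqP; rewrite eq_complex /=; apply/andP; split; apply/eqP; last by ring.
  by rewrite mulr2n; lra.
have s4 : 0 <= 4 * sin u ^+ 2 by rewrite mulr_ge0 ?sqr_ge0.
rewrite cosE normc_real normrN (ger0_norm s4) in small.
have su := sin_ge_half u01.
have p2 := pi_ge2 R.
(* Here sin u >= u/2 = pi |n| h / 2 >= |n| h, by pi >= 2. *)
have lower : (`|n|%:R * h) ^+ 2 * 4 <= 4 * sin u ^+ 2.
  have k1 : `|n|%:R * h <= u / 2.
    by rewrite /u -mulrA mulrC mulrA; move: (mulr_ge0 n0 (ltW h0)) => ?; nra.
  have k0 : 0 <= `|n|%:R * h by rewrite mulr_ge0// ltW.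
  by rewrite mulrC ler_pM2l// lerXn2r ?nnegrE ?(le_trans k1)//; lra.
have v0 := normc_ge0 (avg L psi).
have v1 := avg_norm_le L0 dpsi.
have n2 : n%:~R ^+ 2 = `|n|%:R ^+ 2 :> R.
  by rewrite natr_absz intr_norm real_normK ?num_real.
have main : n%:~R ^+ 2 * normc (avg L psi) <= 2 * C2.
  have h2 : 0 < h ^+ 2 * 4 by rewrite mulr_gt0 ?exprn_gt0.
  rewrite -(ler_pM2l h2).
  have := ler_wpM2r v0 lower; rewrite n2 exprMn => m1.
  have : h ^+ 2 * 4 * (`|n|%:R ^+ 2 * normc (avg L psi)) =
    `|n|%:R ^+ 2 * h ^+ 2 * 4 * normc (avg L psi) by ring.
  move=> ->; apply: (le_trans m1); apply: (le_trans small).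
  by rewrite le_eqVlt; apply/orP; left; apply/eqP; ring.
rewrite mulrDr mulr1 addrC mulrC; exact: lerD.
Qed.

End poisson.

Section poisson_summation.
Variable R : realType.
Local Notation cpi := (@cpi R).

(** Comparison with the telescoping series of 4/(k + 1) - 4/(k + 2), of sum 4; passing to the
    integers doubles it. *)
Lemma inv_sq_bound : sum_bound (fun n : int => ((1 + n%:~R ^+ 2)^-1 : R)%:C%C) 8.
Proof.
have -> : 8 = 2 * 4 :> R by ring.
have := @sum_bound_int R (fun k => (1 + k%:R ^+ 2)^-1) 4.
move=> h; apply: (sum_bound_le _ (h _ _)).
- by move=> n; rewrite natr_absz intr_norm real_normK ?num_real.
- by move=> k; rewrite invr_ge0 addr_ge0 ?sqr_ge0.
move=> n; suff : \sum_(k < n) (1 + k%:R ^+ 2)^-1 <= 4 - 4 / (n%:R + 1) :> R.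
  by move=> /le_trans; apply; rewrite gerBl divr_ge0// addr_ge0.
elim: n => [|n IH]; first by rewrite big_ord0 add0r divr1 subrr.
rewrite big_ord_recr /= -(natr1 n); move: IH; set S := \sum_(i < n) _.
have n0 : 0 <= n%:R :> R by rewrite ler0n.
move: n%:R n0 => x x0 IH.
have d1 : 0 < 1 + x ^+ 2 by rewrite ltr_pwDl ?sqr_ge0.
have d2 : 0 < x + 1 by lra.
have d3 : 0 < x + 1 + 1 by lra.
have : (1 + x ^+ 2)^-1 <= 4 / (x + 1) - 4 / (x + 1 + 1).
  have -> : 4 / (x + 1) - 4 / (x + 1 + 1) = 4 / ((x + 1) * (x + 1 + 1)).
    by field; rewrite !gt_eqF.
  rewrite ler_pdivlMr ?mulr_gt0// mulrC ler_pdivrMr//; nra.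
by move=> /(lerD IH); rewrite subrKA.
Qed.

(** Completing the square: the character is absorbed by moving the line by i n / s, which leaves the
    dual theta term as a constant. Hence the need for complex [b] in [avg_gauss_line]. *)
Lemma gauss_char (s : R[i]) (al : R) (n : int) (x : R) : s != 0 ->
  gauss (s * x%:C%C + s * al%:C%C) * char n%:~R x%:C%C =
  Psi_term (s ^+ 2)^-1 al n *
    gauss (s * x%:C%C + (s * al%:C%C + 'i%C * n%:~R / s)).
Proof.
move=> s0; rewrite /gauss /char /Psi_term -!cexpD; congr cexp.
have i2 : 'i%C * 'i%C = -1 :> R[i] by rewrite -expr2 sqr_i.
have -> : (s ^+ 2)^-1 = s^-1 * s^-1 by rewrite expr2 invfM.
have sv : s * s^-1 = 1 by rewrite divff.
move: (s^-1) sv => v sv.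
have -> : - cpi * (s * x%:C%C + (s * al%:C%C + 'i%C * n%:~R * v)) ^+ 2 =
  - cpi * ((s * x%:C%C + s * al%:C%C) ^+ 2 +
    2 * 'i%C * n%:~R * (x%:C%C + al%:C%C) * (s * v)
    + ('i%C * 'i%C) * n%:~R ^+ 2 * (v * v)) by ring.
by rewrite sv i2; ring.
Qed.

Lemma poisson_approx (s : R[i]) (al : R) : in_sector s ->
  forall e : R, 0 < e -> exists K0, forall K, (K0 <= K)%N ->
  normc (s * Theta (s ^+ 2) al -
    avg K.*2.+1 (fun x : R => gauss x%:C%C) * Psi (s ^+ 2)^-1 al) <= e.
Proof.
move=> ss; have s0 := sector_neq0 ss.
have sP := Psi_summable al (Re_inv_gt0 (sector_Re ss)).
pose phi (x : R) := gauss (s * x%:C%C + s * al%:C%C).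
pose g (K : nat) := avg K.*2.+1 (fun x : R => gauss x%:C%C).
pose v (K : nat) (n : int) := s * avg K.*2.+1 (fun x => phi x * char n%:~R x%:C%C).
have [B B0 hB] := avg_fourier_decay al ss.
have re1 : 0 < complex.Re ((1 : R[i]) ^+ 2) by rewrite expr1n.
have [C0 C00 hC0] := gauss_dominated 0 re1 (ler01 : 0 <= 1 :> R).
have dg : exp_dominated (fun x : R => gauss x%:C%C) C0.
  move=> x; have := hC0 1 0 x (lexx _); rewrite normc0 normc1 lexx ler01 => /(_ isT isT).
  by rewrite expr0 !mul1r addr0.
have [C1 C10 hC1] := gauss_dominated 0 (sector_Re ss)
   (addr_ge0 (normc_ge0 s) (normc_ge0 (s * al%:C%C))).
have dphi : exp_dominated phi C1.
  move=> x; have := hC1 s (s * al%:C%C) x (lexx _).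
  by rewrite lerDl lerDr !normc_ge0 expr0 mul1r => /(_ isT isT).
have ng K : normc (g K) <= 4 * C0 by apply: avg_norm_le.
(* Cutting at |n| <= K turns the finite Fourier sum into a series over the integers, comparable term
   by term with the dual series. The factor [g K], an approximate Gaussian integral, is only known
   to be bounded at this stage. *)
pose a (K : nat) (n : int) :=
  (if (`|n| <= K)%N then v K n else 0) - g K * Psi_term (s ^+ 2)^-1 al n.
have ThetaE K : s * Theta (s ^+ 2) al = csum (fun n : int => if (`|n| <= K)%N then v K n else 0).
  have -> : Theta (s ^+ 2) al = csum (fun n : int => phi n%:~R).
    rewrite /Theta; congr csum; apply/funext => n; rewrite /phi /gauss intC.
    by congr cexp; ring.
  rewrite (csum_fourier K dphi) mulr_sumr.
  have vE (i : 'I_K.*2.+1) :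
    s * avg K.*2.+1 (fun x => phi x * char (i%:R - K%:R) x%:C%C) = v K (i%:Z - K%:Z).
    by rewrite /v intrB -!pmulrn.
  rewrite (eq_bigr _ (fun i _ => vE i)).
  pose dl (i : 'I_K.*2.+1) (n : int) := if n == i%:Z - K%:Z then v K (i%:Z - K%:Z) else 0.
  rewrite (eq_bigr (fun i => csum (dl i))); last by move=> i _; rewrite csum_delta.
  rewrite -csum_bigsum; last by move=> i; apply: abs_summable_delta.
  congr csum; apply/funext => n; case: ifPn => nK; last first.
    rewrite big1// => i _; rewrite /dl; case: eqP => // ni.
    by move/negP: nK; case; have := ltn_ord i; lia.
  have io : (absz (n + K%:Z)%R < K.*2.+1)%N by lia.
  have ni : n = (absz (n + K%:Z)%R)%:Z - K%:Z by lia.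
  rewrite (bigD1 (Ordinal io))//= /dl /= -ni eqxx big1 ?addr0// => i iO.
  case: eqP => // ni'; move/eqP: iO; case; apply/val_inj => /=; lia.
have saf K : abs_summable (fun n : int => if (`|n| <= K)%N then v K n else 0).
  have := abs_summable_bigsum (index_enum 'I_K.*2.+1)
    (fun i : 'I_K.*2.+1 => abs_summable_delta (i%:Z - K%:Z) (v K (i%:Z - K%:Z))).
  apply: abs_summable_le => n; case: ifPn => nK; last by rewrite normc0 normc_ge0.
  have io : (absz (n + K%:Z)%R < K.*2.+1)%N by lia.
  have ni : n = (absz (n + K%:Z)%R)%:Z - K%:Z by lia.
  rewrite (bigD1 (Ordinal io))//= -ni eqxx big1 ?addr0// => i iO.
  case: eqP => // ni'; move/eqP: iO; case; apply/val_inj => /=; lia.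
have aE K : s * Theta (s ^+ 2) al - g K * Psi (s ^+ 2)^-1 al = csum (a K).
  by rewrite (ThetaE K) /Psi -csumZ// -csumB//; apply: abs_summableZ.
have [M hM] := sP.
pose D (n : int) : R := normc s * B * (1 + n%:~R ^+ 2)^-1
  + 4 * C0 * normc (Psi_term (s ^+ 2)^-1 al n).
have DK (A : {fset int}) : \sum_(n <- A) D n <= normc s * B * 8 + 4 * C0 * M.
  rewrite /D big_split /= -!mulr_sumr; apply: lerD.
    apply: ler_wpM2l; first by rewrite mulr_ge0 ?normc_ge0.
    have := inv_sq_bound A; under eq_bigr do rewrite normc_real ger0_norm ?invr_ge0 ?addr_ge0 ?sqr_ge0//.
    by [].
  by apply: ler_wpM2l; rewrite ?mulr_ge0.
have aD K n : normc (a K n) <= D n.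
  rewrite /a /D (le_trans (le_normcD _ _))// normcN (normcM (g K)); apply: lerD.
    have d0 : 0 < 1 + n%:~R ^+ 2 :> R by rewrite ltr_pwDl ?sqr_ge0.
    case: ifPn => nK; last first.
      by rewrite normc0 mulr_ge0 ?invr_ge0 ?(ltW d0)// mulr_ge0 ?normc_ge0.
    by rewrite /v normcM -mulrA ler_wpM2l ?normc_ge0// ler_pdivlMr// hB.
  by rewrite ler_wpM2r ?normc_ge0.
(* For fixed n the cut is inactive once K >= |n|; what remains is the difference of Gaussian
   averages along two lines, of order 1/K. *)
have a0 n (e : R) : 0 < e -> exists K0, forall K, (K0 <= K)%N -> normc (a K n) <= e.
  move=> e0; have [C hC] := avg_gauss_line (s * al%:C%C + 'i%C * n%:~R / s) ss.
  pose q := normc (Psi_term (s ^+ 2)^-1 al n) * C / e.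
  exists (maxn `|n| (Num.truncn `|q|).+1) => K; rewrite geq_max => /andP[nK qK].
  have L0 : (0 < K.*2.+1)%N by [].
  rewrite /a nK.
  have -> : v K n = Psi_term (s ^+ 2)^-1 al n *
     avg K.*2.+1 (fun x => s * gauss (s * x%:C%C + (s * al%:C%C + 'i%C * n%:~R / s))).
    have [C2 _ hC2] := gauss_dominated 0 (sector_Re ss) (addr_ge0 (normc_ge0 s)
      (normc_ge0 (s * al%:C%C + 'i%C * n%:~R / s))).
    have dl : exp_dominated (fun x : R =>
        gauss (s * x%:C%C + (s * al%:C%C + 'i%C * n%:~R / s))) C2.
      move=> x; have := hC2 s (s * al%:C%C + 'i%C * n%:~R / s) x (lexx _).
      by rewrite lerDl lerDr !normc_ge0 expr0 mul1r => /(_ isT isT).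
    have A1 := avgZ L0 s dl.
    have A2 := avgZ L0 (Psi_term (s ^+ 2)^-1 al n) dl.
    have A3 : (fun x => phi x * char n%:~R x%:C%C) = (fun x =>
        Psi_term (s ^+ 2)^-1 al n *
        gauss (s * x%:C%C + (s * al%:C%C + 'i%C * n%:~R / s))).
      by apply/funext => x; rewrite /phi gauss_char.
    by rewrite /v A3 A2 A1; apply: mulrCA.
  rewrite (mulrC (g K)) -mulrBr normcM.
  have LR : 0 < K.*2.+1%:R :> R by rewrite ltr0n.
  apply: (le_trans (ler_wpM2l (normc_ge0 _) (hC _ L0))).
  rewrite mulrA ler_pdivrMr// -ler_pdivrMl// mulrC -/q (le_trans (ler_norm _))//.
  have := truncnS_gt `|q|; move=> /ltW /le_trans; apply; rewrite ler_nat.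
  by rewrite (leq_trans qK)// -addnn -addnS leq_addr.
move=> e e0; have [K0 hK0] := csum_dominated DK aD a0 e0.
by exists K0 => K /hK0; rewrite -aE.
Qed.

(** For s = 1 and al = 0 both sides are the same series, of modulus at least 1, so [poisson_approx]
    forces g K to tend to 1. This is the value of the Gaussian integral, and it settles the general
    case. *)
Theorem poisson_theta (s : R[i]) (al : R) : in_sector s ->
  s * Theta (s ^+ 2) al = Psi (s ^+ 2)^-1 al.
Proof.
move=> ss; pose g (K : nat) := avg K.*2.+1 (fun x : R => gauss x%:C%C).
have s1 : in_sector (1 : R[i]) by rewrite /in_sector /= normr0.
have T1 : @Theta R (1 ^+ 2) 0 = Psi (1 ^+ 2)^-1 0.
  rewrite /Theta /Psi; congr csum; apply/funext => n; rewrite /Psi_term.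
  by rewrite expr1n invr1 rmorph0 mulr0 !addr0.
have P1 : 1 <= normc (@Psi R (1 ^+ 2)^-1 0).
  apply: le_trans (normc_Re _); apply: le_trans (ler_norm _).
  have -> : 1 = complex.Re (@Psi_term R (1 ^+ 2)^-1 0 0).
    by rewrite /Psi_term mulr0z [0 ^+ 2]expr2 !(mulr0, mul0r) addr0 cexp0.
  apply: csum_Re_ge; first by apply: Psi_summable; rewrite expr1n invr1.
  move=> n; rewrite /Psi_term expr1n invr1 rmorph0 !mulr0 addr0 mulr1.
  rewrite -intC -rmorphXn /cexp /cpi /=.
  rewrite !(oppr0, mul0r, mulr0, addr0, subr0, mul1r) cos0 mulr1.
  exact: expR_ge0.
apply/eqP; rewrite -subr_eq0; apply/eqP/normc_eq0_small => e e0.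
pose P := Psi (s ^+ 2)^-1 al.
have p0 : 0 < normc P + 1 by rewrite ltr_wpDl ?normc_ge0.
have e1 : 0 < e / 2 / (normc P + 1) by rewrite !divr_gt0.
have e2 : 0 < e / 2 by rewrite divr_gt0.
have [K1 h1] := poisson_approx 0 s1 e1.
have [K2 h2] := poisson_approx al ss e2.
have := h1 _ (leq_maxl K1 K2); have := h2 _ (leq_maxr K1 K2).
rewrite -!/(g _); set G := g _; rewrite mul1r T1 -/P.
have -> : Psi (1 ^+ 2)^-1 0 - G * Psi (1 ^+ 2)^-1 0 = (1 - G) * Psi (1 ^+ 2)^-1 0.
  by ring.
rewrite normcM => i2 i1.
have i3 : normc (1 - G) <= e / 2 / (normc P + 1).
  by apply: le_trans i1; rewrite ler_peMr ?normc_ge0.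
have -> : s * Theta (s ^+ 2) al - P = (s * Theta (s ^+ 2) al - G * P) - (1 - G) * P.
  by ring.
rewrite (le_trans (le_normcD _ _))// normcN normcM.
have : normc (1 - G) * normc P <= e / 2.
  move: i3; rewrite ler_pdivlMr//; apply: le_trans.
  by rewrite ler_wpM2l ?normc_ge0// lerDl.
lra.
Qed.

End poisson_summation.

(** * Reduction to one-dimensional theta series *)

Section theta_product.
Variable R : realType.
Local Notation cpi := (@cpi R).

Lemma csum_rV (a : int -> R[i]) n : abs_summable a ->
  abs_summable (fun x : 'rV[int]_n => \prod_i a (x 0 i)) /\
  csum (fun x : 'rV[int]_n => \prod_i a (x 0 i)) = csum a ^+ n.
Proof.
move=> sa; elim: n => [|n [IHs IH]].
  have -> : (fun x : 'rV[int]_0 => \prod_i a (x 0 i)) =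
      (fun x => if x == 0 then 1 else 0).
    by apply/funext => x; rewrite big_ord0 (thinmx0 x) eqxx.
  by rewrite csum_delta expr0; split => //; apply: abs_summable_delta.
pose psi (x : 'rV[int]_n.+1) : int * 'rV[int]_n :=
  (x 0 ord0, \row_i x 0 (lift ord0 i)).
pose b (p : int * 'rV[int]_n) := a p.1 * \prod_i a (p.2 0 i).
have psi_inj : injective psi.
  move=> x y [h0 h1]; apply/rowP => i; case: (unliftP ord0 i) => [j|] -> //.
  by move/rowP/(_ j): h1; rewrite !mxE.
have psi_surj p : exists x, psi x = p.
  exists (\row_i (if unlift ord0 i is Some j then p.2 0 j else p.1)).
  rewrite /psi; case: p => p q /=; congr pair; first by rewrite mxE unlift_none.
  by apply/rowP => i; rewrite !mxE liftK.
have E : (fun x : 'rV[int]_n.+1 => \prod_i a (x 0 i)) = b \o psi.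
  apply/funext => x; rewrite big_ord_recl /b /=; congr (_ * _).
  by apply: eq_bigr => i _; rewrite mxE.
have sb : abs_summable b := abs_summable_prod sa IHs.
rewrite E; split; first by apply: (@abs_summable_inj R _ _ psi b).
rewrite -csum_support//; last by move=> p h; have [x /h] := psi_surj p.
by rewrite (csum_prod sa IHs) IH exprS.
Qed.

Lemma prod_cexp (I : finType) (f : I -> R[i]) :
  \prod_i cexp (f i) = cexp (\sum_i f i).
Proof. by elim/big_rec2: _ => [|i y z _ ->]; rewrite ?cexp0// cexpD. Qed.

Lemma root_sum_int (n : nat) (S : int) :
  \sum_(r < n.+1) cexp (- (2 * 'i%C * cpi) * r%:R * (S%:~R / n.+1%:R)) =
  if (n.+1%:Z %| S)%Z then n.+1%:R else 0.
Proof.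
have N0 : n.+1%:R != 0 :> R[i] by rewrite pnatr_eq0.
have jN : (absz (S %% n.+1)%Z < n.+1)%N.
  by rewrite -ltz_nat gez0_abs ?modz_ge0// ltz_pmod.
have := @root_sum R n.+1 (absz (S %% n.+1)%Z) 0 jN.
have -> : (absz (S %% n.+1)%Z == 0%N) = (n.+1%:Z %| S)%Z.
  by rewrite absz_eq0; apply/eqP/dvdz_mod0P.
move=> <-; apply: eq_bigr => r _; rewrite subr0.
have -> : (absz (S %% n.+1)%Z)%:R = (S %% n.+1)%Z%:~R :> R.
  by rewrite pmulrn gez0_abs ?modz_ge0.
rewrite rmorphM fmorphV /= rmorph_nat intC.
have -> : S%:~R / n.+1%:R =
    ((S %/ n.+1)%Z)%:~R + ((S %% n.+1)%Z)%:~R / n.+1%:R :> R[i].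
  by rewrite {1}(divz_eq S n.+1) intrD intrM mulrDl mulfK.
rewrite mulrDr cexpD -[X in _ = X]mul1r; congr (_ * _).
have -> : - (2 * 'i%C * cpi) * r%:R * ((S %/ n.+1)%Z)%:~R =
    2 * 'i%C * cpi * (- (r%:Z * (S %/ n.+1)%Z))%:~R.
  by rewrite mulrNz intrM -pmulrn; ring.
exact: cexp_2pii.
Qed.

(** The right-hand side is the squared length of the sum-zero vector (y, - sum of y). *)
Lemma theta_double n (y : 'rV[int]_n) :
  2 * theta y = \sum_i y 0 i ^+ 2 + (\sum_i y 0 i) ^+ 2.
Proof.
rewrite /theta mulrDr.
have -> : (\sum_i y 0 i) ^+ 2 = \sum_i y 0 i ^+ 2 +
    2 * \sum_(i < n) \sum_(j < n | (i < j)%N) y 0 i * y 0 j.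
  rewrite expr2 big_distrlr /=.
  have split3 (i : 'I_n) : \sum_(j < n) y 0 i * y 0 j = y 0 i ^+ 2 +
     (\sum_(j < n | (i < j)%N) y 0 i * y 0 j + \sum_(j < n | (j < i)%N) y 0 i * y 0 j).
    rewrite (bigD1 i)//= -expr2; congr (_ + _).
    rewrite (bigID (fun j : 'I_n => (i < j)%N))/=; congr (_ + _); apply: eq_bigl => j.
      by rewrite andb_idl// => h; apply/eqP => ji; rewrite ji ltnn in h.
    by rewrite -leqNgt ltn_neqAle; congr (_ && _).
  rewrite (eq_bigr _ (fun i _ => split3 i)) !big_split /=; congr (_ + _).
  rewrite mulr_natl mulr2n; congr (_ + _).
  rewrite (exchange_big_dep xpredT)//=; apply: eq_bigr => i _.
  by apply: eq_bigr => j _; rewrite mulrC.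
ring.
Qed.

(* Sum-zero vectors and multiples of (1, ..., 1) span the sublattice {x | n+1 divides the
   coordinate sum} of Z^(n+1), orthogonally; f_theta is the theta series of the former. *)
Lemma theta_product (n : nat) (z : R[i]) : 0 < complex.Im z ->
  \sum_(r < n.+1) Psi (- 'i%C * z) (1 / 2 - r%:R / n.+1%:R) ^+ n.+1 =
  n.+1%:R * (f_theta n z * Psi (- 'i%C * z * n.+1%:R) (n.+1%:R / 2)).
Proof.
move=> z0; set l := - 'i%C * z.
have l0 : 0 < complex.Re l.
  by move: z0; rewrite /l; case: (z) => a b /=; rewrite !(oppr0, mul0r) mulN1r sub0r opprK.
have N0 : n.+1%:R != 0 :> R by rewrite pnatr_eq0.
have NC : n.+1%:R != 0 :> R[i] by rewrite pnatr_eq0.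
pose F r (x : 'rV[int]_n.+1) :=
  \prod_i Psi_term l (1 / 2 - r%:R / n.+1%:R) (x 0 i).
pose P (x : 'rV[int]_n.+1) := \prod_i Psi_term l (1 / 2) (x 0 i).
have sF r : abs_summable (F r) := (csum_rV n.+1 (Psi_summable _ l0)).1.
have sP : abs_summable P := (csum_rV n.+1 (Psi_summable _ l0)).1.
rewrite (eq_bigr (fun r : 'I_n.+1 => csum (F r))); last first.
  by move=> r _; rewrite (csum_rV n.+1 (Psi_summable _ l0)).2.
rewrite -csum_bigsum; last by move=> r; apply: sF.
pose Q (x : 'rV[int]_n.+1) :=
  P x * (if (n.+1%:Z %| \sum_i x 0 i)%Z then n.+1%:R else 0).
(* The r-th product differs from [P] by the character e(- r S / N) of the coordinate sum S; summing
   over r leaves N times the indicator of N | S. *)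
have FE : (fun x => \sum_(r < n.+1) F r x) = Q.
  apply/funext => x; rewrite /Q -root_sum_int mulr_sumr; apply: eq_bigr => r _.
  rewrite /F /P /Psi_term !prod_cexp -cexpD; congr cexp.
  rewrite rmorph_sum /= mulr_suml mulr_sumr -big_split /=; apply: eq_bigr => i _.
  by rewrite rmorphB !rmorphM !fmorphV /= !rmorph_nat rmorph1; ring.
have sQ : abs_summable Q.
  by rewrite -FE; apply: abs_summable_bigsum.
rewrite FE.
(* The sum-zero vector attached to y, plus j (1, ..., 1). Its squared length is 2 theta(y) + N j^2
   and its coordinate sum N j, so [P] factors and the characteristic 1/2 becomes N/2 on the j
   side. *)
pose phi (p : 'rV[int]_n * int) : 'rV[int]_n.+1 := \row_i
  (if unlift ord_max i is Some j then p.1 0 j + p.2 else p.2 - \sum_j p.1 0 j).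
have phil p j : phi p 0 (lift ord_max j) = p.1 0 j + p.2 by rewrite mxE liftK.
have phim p : phi p 0 ord_max = p.2 - \sum_j p.1 0 j by rewrite mxE unlift_none.
have big_max (V : zmodType) (g : 'I_n.+1 -> V) :
    \sum_i g i = \sum_(j < n) g (lift ord_max j) + g ord_max.
  rewrite big_ord_recr /=; congr (_ + _); apply: eq_bigr => j _; congr g.
  by apply/val_inj; rewrite /= /bump leqNgt ltn_ord.
have nE : n.+1%:Z = n%:Z + 1 by rewrite -addn1 PoszD.
have mn (u : int) : u *+ n = n%:Z * u by rewrite -mulr_natl natz.
have phis p : \sum_i phi p 0 i = n.+1%:Z * p.2.
  rewrite big_max phim (eq_bigr _ (fun j _ => phil p j)) big_split /=.
  by rewrite sumr_const card_ord nE mn; ring.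
have phi_inj : injective phi.
  move=> p p' pp'; have := phis p; rewrite pp' phis => /mulfI => /(_ isT) p2.
  have p1 : p.1 = p'.1.
    by apply/rowP => j; have := phil p j; rewrite pp' phil -p2 => /addIr.
  by case: p p' p1 p2 {pp'} => [? ?] [? ?] /= -> ->.
rewrite (csum_support phi_inj) //; last first.
  move=> x hx; rewrite /Q; case: ifP => [|_]; last by rewrite mulr0.
  move=> /dvdzP[q hq]; case: (hx (\row_j (x 0 (lift ord_max j) - q), q)).
  apply/rowP => i; case: (unliftP ord_max i) => [j|] ->.
    by rewrite phil /= mxE subrK.
  rewrite phim /= (eq_bigr (fun j => x 0 (lift ord_max j) - q)); last first.
    by move=> j _; rewrite mxE.
  rewrite big_split /= sumr_const card_ord.
  move: hq; rewrite big_max nE mn => hq.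
  apply/eqP; rewrite -subr_eq0; apply/eqP.
  move: (\sum_(j < n) x 0 (lift ord_max j)) (x 0 ord_max) hq => s u hq.
  have -> : u = q * (n%:Z + 1) - s by rewrite -hq; ring.
  ring.
pose fy (y : 'rV[int]_n) := qexp z ^ theta y.
pose gj (j : int) := Psi_term (l * n.+1%:R) (n.+1%:R / 2) j.
have PE p : P (phi p) = fy p.1 * gj p.2.
  rewrite /P /Psi_term prod_cexp /fy /gj /qexp -cexp_intM -cexpD; congr cexp.
  rewrite big_split /= -mulr_sumr -mulr_suml -mulr_sumr.
  rewrite -(rmorph_sum (intr : int -> R[i])) /= phis.
  have -> : \sum_i (phi p 0 i)%:~R ^+ 2 = (2 * theta p.1 + n.+1%:Z * p.2 ^+ 2)%:~R :> R[i].
    under eq_bigr do rewrite -rmorphXn /=.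
    rewrite -rmorph_sum /= big_max phim; congr (_%:~R).
    under eq_bigr do rewrite phil sqrrD.
    rewrite !big_split /= sumr_const card_ord theta_double nE.
    rewrite -mulr_suml.
    by rewrite mn; ring.
  have h2 : (1 / 2 : R)%:C%C = 1 / 2 by rewrite rmorphM fmorphV /= rmorph1 rmorph_nat.
  have hn : (n.+1%:R / 2 : R)%:C%C = n.+1%:R / 2.
    by rewrite rmorphM fmorphV /= !rmorph_nat.
  have hN : (n.+1%:Z)%:~R = n.+1%:R :> R[i] by [].
  have hp : (p.2 ^+ 2)%:~R = p.2%:~R ^+ 2 :> R[i] by rewrite rmorphXn.
  rewrite h2 hn !(hp, intrD, intrM) hN /l -/cpi.
  move: cpi ((theta p.1)%:~R : R[i]) (p.2%:~R : R[i]) (n.+1%:R : R[i]) => c t u v.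
  by field.
(* The slice j = 0 of the summable family [P] is [fy]. *)
have sy : abs_summable fy.
  have := @abs_summable_inj R _ _ (fun y : 'rV[int]_n => phi (y, 0)) P _ sP.
  have i0 : injective (fun y : 'rV[int]_n => phi (y, 0)) by move=> y y' /phi_inj[].
  move=> /(_ i0); apply: abs_summable_le => y; rewrite /= PE /= /gj /Psi_term.
  by rewrite mulr0z expr2 !(mulr0, mul0r) addr0 cexp0 mulr1.
have sj : abs_summable gj.
  apply: Psi_summable; move: l0; case: (l) => a b /= a0.
  by rewrite -(rmorph_nat (real_complex R)) /= mulr0 subr0 mulr_gt0// ltr0n.
have -> : Q \o phi = fun p => n.+1%:R * (fy p.1 * gj p.2).
  apply/funext => p; rewrite /Q /= phis dvdz_mulr// PE; ring.
rewrite csumZ; last exact: abs_summable_prod.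
by rewrite csum_prod.
Qed.

End theta_product.

(** * Limits at the cusp *)

Section cusp_limit.
Variable R : realType.
Implicit Types (f g : R[i] -> R[i]) (l m : R[i]).

Definition cusp_lim f l : Prop := forall e : R, 0 < e ->
  exists M : R, forall z, M < complex.Im z -> normc (f z - l) < e.

Lemma cusp_limP f l : cusp_lim f l ->
  f z @[z --> @i_infty R] --> (l : R[i]^o).
Proof.
move=> fl; apply/(@cvgrPdist_lt R[i] R[i]^o _ _ (i_infty_filter R)) => e e0.
have /andP[/eqP eI eR] : (complex.Im e == 0) && (0 < complex.Re e).
  by move: e0; rewrite ltcE /= => /andP[-> ->].
have [M hM] := fl _ eR; exists M => // z /= /hM.
rewrite normcB -ltcR.
by have -> : e = (complex.Re e)%:C%C by rewrite [LHS]complexE eI mulr0 addr0.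
Qed.

Lemma cusp_lim_cst l : cusp_lim (fun=> l) l.
Proof. by move=> e e0; exists 0 => z _; rewrite subrr normc0. Qed.

Lemma cusp_limD f g l m :
  cusp_lim f l -> cusp_lim g m -> cusp_lim (fun z => f z + g z) (l + m).
Proof.
move=> fl gm e e0; have e2 : 0 < e / 2 by rewrite divr_gt0.
have [M hM] := fl _ e2; have [M' hM'] := gm _ e2.
exists (Num.max M M') => z; rewrite gt_max => /andP[/hM h1 /hM' h2].
have -> : f z + g z - (l + m) = (f z - l) + (g z - m) by ring.
rewrite (le_lt_trans (le_normcD _ _))//; lra.
Qed.

Lemma cusp_limM f g l m :
  cusp_lim f l -> cusp_lim g m -> cusp_lim (fun z => f z * g z) (l * m).
Proof.
move=> fl gm e e0; set K := normc l + normc m + 1.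
have nl := normc_ge0 l; have nm := normc_ge0 m.
have K0 : 0 < K by rewrite /K; lra.
pose h := Num.min 1 (e / (2 * K)).
have h0 : 0 < h by rewrite lt_min ltr01 divr_gt0// mulr_gt0.
have h1 : h <= 1 by rewrite ge_min lexx.
have he : h * K <= e / 2.
  have : h <= e / (2 * K) by rewrite ge_min lexx orbT.
  rewrite -(ler_pM2r K0) => /le_trans; apply.
  by rewrite invfM mulrA mulfVK// gt_eqF.
have [M hM] := fl _ h0; have [M' hM'] := gm _ h0.
exists (Num.max M M') => z; rewrite gt_max => /andP[/hM i1 /hM' i2].
have -> : f z * g z - l * m =
  (f z - l) * (g z - m) + (l * (g z - m) + m * (f z - l)) by ring.
rewrite (le_lt_trans (le_normcD _ _))//.
have := le_normcD (l * (g z - m)) (m * (f z - l)); rewrite !normcM => t.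
have x0 := normc_ge0 (f z - l); have y0 := normc_ge0 (g z - m).
have m1 := ler_wpM2l nl (ltW i2); have m2 := ler_wpM2l nm (ltW i1).
have m3 : normc (f z - l) * normc (g z - m) <= 1 * h.
  by apply: ler_pM => //; lra.
have : h * K = h * normc l + h * normc m + h by rewrite /K; ring.
move: m1 m2 m3 t; rewrite mul1r ![_ * h]mulrC; lra.
Qed.

Lemma cusp_limX f l n : cusp_lim f l -> cusp_lim (fun z => f z ^+ n) (l ^+ n).
Proof.
move=> fl; elim: n => [|n IH]; first exact: cusp_lim_cst.
by move=> e e0; have [M hM] := cusp_limM fl IH e0; exists M => z; rewrite !exprS; apply: hM.
Qed.

Lemma cusp_lim_sum (I : Type) (s : seq I) (f : I -> R[i] -> R[i]) (l : I -> R[i]) :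
  (forall i, cusp_lim (f i) (l i)) ->
  cusp_lim (fun z => \sum_(i <- s) f i z) (\sum_(i <- s) l i).
Proof.
move=> fl; elim: s => [|i s IH] e e0.
  by exists 0 => z _; rewrite !big_nil subrr normc0.
have [M hM] := cusp_limD (fl i) IH e0.
by exists M => z; rewrite !big_cons; apply: hM.
Qed.

(** Eventually |g| >= 1/2, so |f| <= 2 (|l| + 1), and f - l = (f g - l) - f (g - 1). *)
Lemma cusp_lim_quot f g l :
  cusp_lim (fun z => f z * g z) l -> cusp_lim g 1 -> cusp_lim f l.
Proof.
move=> fl g1 e e0; have e2 : 0 < e / 2 by rewrite divr_gt0.
have nl := normc_ge0 l.
pose K := 2 * (normc l + 1).
have K0 : 0 < K by rewrite /K; lra.
have [M1 h1] := fl _ e2; have [M2 h2] := fl _ ltr01.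
have [M3 h3] := g1 _ (divr_gt0 ltr01 (ltr0Sn R 1)).
have [M4 h4] := g1 _ (divr_gt0 e2 K0).
exists (Num.max (Num.max M1 M2) (Num.max M3 M4)) => z.
rewrite !gt_max => /andP[/andP[/h1 i1 /h2 i2] /andP[/h3 i3 /h4 i4]].
have fg : normc (f z) * normc (g z) <= normc l + 1.
  rewrite -normcM; have := le_normcD (f z * g z - l) l; rewrite subrK; lra.
have gg : 1 / 2 <= normc (g z).
  have := le_normcD (g z) (- (g z - 1)).
  have -> : g z - (g z - 1) = 1 by ring.
  rewrite normc1 normcN; lra.
have fK : normc (f z) <= K by have := normc_ge0 (f z); rewrite /K; nra.
have -> : f z - l = (f z * g z - l) - f z * (g z - 1) by ring.
rewrite (le_lt_trans (le_normcD _ _))// normcN normcM.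
have : normc (f z) * normc (g z - 1) <= K * (e / 2 / K).
  by apply: ler_pM; rewrite ?normc_ge0// ltW.
have -> : K * (e / 2 / K) = e / 2 by rewrite mulrC mulfVK// gt_eqF.
lra.
Qed.

(** For n <> 0 and x = Re l >= 2 one has pi x n^2 >= x + |n|, so the terms are at most exp (-|n|) /
    x; the 4 bounds the sum of exp (-|n|). Only Re l enters, whence uniformity in Re z at the
    cusp. *)
Lemma Psi_sub1_le (l : R[i]) (al : R) : 2 <= complex.Re l ->
  normc (Psi l al - 1) <= 4 / complex.Re l.
Proof.
move=> l2; have l0 : 0 < complex.Re l by lra.
have sP := Psi_summable al l0.
have -> : Psi l al - 1 =
    csum (fun n : int => Psi_term l al n - (if n == 0 then 1 else 0)).
  by rewrite csumB ?csum_delta//; apply: abs_summable_delta.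
apply: csum_norm_le => B.
apply: (@le_trans _ _ ((complex.Re l)^-1 * (4 * 1%:R))); last by rewrite mulr1 mulrC.
apply: le_trans (ler_wpM2l _ (geometric_bound R (isT : (0 < 1)%N) B)); last first.
  by rewrite invr_ge0 ltW.
rewrite mulr_sumr; apply: ler_sum => n _.
rewrite normc_real (ger0_norm (expR_ge0 _)) divr1.
have [->|n0] := eqVneq n 0.
  rewrite /Psi_term mulr0z expr2 !(mulr0, mul0r) addr0 cexp0 subrr normc0.
  by rewrite mulr_ge0 ?expR_ge0 ?invr_ge0 ?(ltW l0).
rewrite subr0 Psi_term_norm.
have n1 : 1 <= `|n%:~R| :> R by rewrite -intr_norm ler1z; lia.
have -> : n%:~R ^+ 2 = `|n%:~R| ^+ 2 :> R by rewrite real_normK ?num_real.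
move: `|n%:~R| n1 (complex.Re l) l2 l0 (pi_ge2 R) => u u1 x x2 x0 p2.
have h : expR (- (pi * x * u ^+ 2)) <= expR (- x) * expR (- u) :> R.
  rewrite -expRD ler_expR.
  have q1 : 1 <= u ^+ 2 by rewrite exprn_ege1.
  have q2 : u <= u ^+ 2 by rewrite expr2 ler_peMr// (le_trans ler01).
  have q3 : 2 * (x * u ^+ 2) <= pi * (x * u ^+ 2).
    by rewrite ler_wpM2r// mulr_ge0 ?sqr_ge0// ltW.
  have q4 : x <= x * u ^+ 2 by rewrite ler_peMr// ltW.
  have q5 : 2 * u <= x * u ^+ 2.
    by apply: ler_pM => //; rewrite (le_trans ler01).
  rewrite -mulrA; lra.
apply: (le_trans h); rewrite ler_wpM2r ?expR_ge0// expRN lef_pV2 ?posrE ?expR_gt0//.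
by apply: le_trans (expR_ge1Dx _); lra.
Qed.

Lemma cusp_lim_Psi (c : R) (sigma : R[i] -> R[i]) (al : R) : 0 < c ->
  (forall z, complex.Re (sigma z) = c * complex.Im z) ->
  cusp_lim (fun z => Psi (sigma z) al) 1.
Proof.
move=> c0 hs e e0; exists ((2 + 4 / e) / c) => z.
rewrite ltr_pdivrMr// [complex.Im z * c]mulrC -hs => h.
have e4 : 0 < 4 / e by rewrite divr_gt0.
have s2 : 2 <= complex.Re (sigma z) by lra.
apply: (le_lt_trans (Psi_sub1_le al s2)).
have s0 : 0 < complex.Re (sigma z) by lra.
rewrite ltr_pdivrMr// mulrC -ltr_pdivrMr//; lra.
Qed.

End cusp_limit.

(** * One-dimensional theta series at the cusp 1/d *)

Section cusp_expansion.
Variable R : realType.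
Local Notation cpi := (@cpi R).

Lemma in_sectorZ (c : R) (s : R[i]) : 0 < c -> in_sector s -> in_sector (c%:C%C * s).
Proof.
move=> c0; case: s => p q; rewrite /in_sector /= !mul0r subr0 addr0.
by rewrite normrM (ger0_norm (ltW c0)) ltr_pM2l.
Qed.

Lemma int_even_half (x : int) : (2 %| x)%Z -> x = 2 * (x %/ 2)%Z.
Proof. by move=> h; rewrite mulrC divzK. Qed.

Lemma dvd2_consecutive (x : int) : (2 %| x * (x + 1))%Z.
Proof.
have [h|h] : x = 2 * (x %/ 2)%Z \/ x + 1 = 2 * ((x + 1) %/ 2)%Z by lia.
  by rewrite h -mulrA dvdz_mulr.
by rewrite h mulrCA dvdz_mulr.
Qed.

Lemma dvd2_odd_quadratic (u v : nat) (j : int) : odd u -> odd v ->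
  (2 %| u%:Z * j ^+ 2 + v%:Z * j)%Z.
Proof.
move=> ou ov; have -> : u%:Z = 2 * u./2%:Z + 1 by lia.
have -> : v%:Z = 2 * v./2%:Z + 1 by lia.
have -> : (2 * u./2%:Z + 1) * j ^+ 2 + (2 * v./2%:Z + 1) * j =
  2 * (u./2%:Z * j ^+ 2 + v./2%:Z * j) + j * (j + 1) by ring.
by apply: rpredD; rewrite ?dvd2_consecutive ?dvdz_mulr.
Qed.

Definition beta (n r : nat) : R := 1 / 2 - r%:R / n.+1%:R.

Definition phase (n d r : nat) : R[i] := cexp (- ('i%C * cpi * d%:R * (beta n r)%:C%C ^+ 2)).

(** [m.+1] is M = N/d. The residue classes mod M of the summation index undergo Poisson summation
    separately, scaled by M. As every [Psi] tends to 1, the average tends to a character sum: 1 if M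
    divides r, and 0 otherwise. *)
Definition PsiAvg (n m r : nat) (tau : R[i]) : R[i] := m.+1%:R^-1 *
  \sum_(p < m.+1) cexp (2 * 'i%C * cpi * p%:R * r%:R / m.+1%:R) *
    Psi (tau / m.+1%:R ^+ 2) ((p%:R + beta n r) / m.+1%:R).

(* Both steps z' -> -1/z' -> -1/z' + d -> Z of the passage from the cusp 1/d to infinity are
   performed on one-dimensional theta series, so that no Gauss sum needs to be evaluated. *)
Lemma Theta_cusp (n m d r : nat) (B : R[i]) : in_sector B -> n.+1 = (m.+1 * d)%N ->
  Theta ('i%C * d%:R + (B ^+ 2)^-1) (beta n r) =
  phase n d r * (B * PsiAvg n m r (B ^+ 2)).
Proof.
move=> sB nmd; have B0 := sector_neq0 sB.
set tau := B ^+ 2; have tau0 : 0 < complex.Re tau := sector_Re sB.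
have tn0 : tau != 0 by rewrite expf_neq0.
have m0 : m.+1%:R != 0 :> R[i] by rewrite pnatr_eq0.
have d0 : d%:R != 0 :> R[i] by rewrite pnatr_eq0; case: d nmd => //; rewrite muln0.
have NC : n.+1%:R = m.+1%:R * d%:R :> R[i] by rewrite nmd natrM.
have re0 : 0 < complex.Re ('i%C * d%:R + tau^-1).
  have := Re_inv_gt0 tau0; case: (tau^-1) => a b.
  by rewrite -(rmorph_nat (real_complex R)) /= !(mul0r, mulr0) subrr add0r.
rewrite /Theta (csum_residues (ltn0Sn m) (theta_summable (beta n r) re0)).
rewrite /PsiAvg !mulr_sumr; apply: eq_bigr => p _.
have Mre : 0 < complex.Re (m.+1%:R ^+ 2 / tau).
  have := Re_inv_gt0 tau0; case: (tau^-1) => a b /= a0.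
  rewrite -(rmorph_nat (real_complex R)) -rmorphXn /= mul0r subr0.
  by apply: mulr_gt0 => //; apply: exprn_gt0; rewrite ltr0n.
have bE : (beta n r)%:C%C = 1 / 2 - r%:R / n.+1%:R.
  by rewrite /beta rmorphB !rmorphM !fmorphV /= !rmorph_nat rmorph1.
transitivity (phase n d r * (cexp (2 * 'i%C * cpi * p%:R * r%:R / m.+1%:R) *
   Theta (m.+1%:R ^+ 2 / tau) ((p%:R + beta n r) / m.+1%:R))); last first.
  have sg : in_sector (m.+1%:R / B).
    rewrite -(rmorph_nat (real_complex R)); apply: in_sectorZ; first by rewrite ltr0n.
    exact: in_sectorV.
  have := poisson_theta ((p%:R + beta n r) / m.+1%:R) sg.
  rewrite expr_div_n -/tau invf_div => <-.
  move: (Theta _ _) => w; move: (phase _ _ _) (cexp _) => u v.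
  move: (m.+1%:R : R[i]) m0 => y y0.
  by field; rewrite y0 B0.
rewrite mulrA /Theta -csumZ; last exact: theta_summable.
congr csum; apply/funext => k; rewrite /phase -!cexpD.
have gE : ((p%:R + beta n r) / m.+1%:R : R)%:C%C = (p%:R + (beta n r)%:C%C) / m.+1%:R.
  by rewrite rmorphM rmorphD fmorphV /= !rmorph_nat.
rewrite gE; set x : int := p%:Z + m.+1%:Z * k.
(* Since d (2 beta) = d - 2r/M, the rotation by i d contributes e(- d x (x + 1) / 2) e(x r / M)
   besides the constant [phase]. The first factor is 1, and the second depends only on p. *)
have xe : x * (x + 1) = 2 * ((x * (x + 1)) %/ 2)%Z by apply: int_even_half; apply: dvd2_consecutive.
set T : int := ((x * (x + 1)) %/ 2)%Z in xe.
have xC : x%:~R = p%:R + m.+1%:R * k%:~R :> R[i] by rewrite intrD intrM.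
have xeC : x%:~R ^+ 2 + x%:~R = 2 * T%:~R :> R[i].
  have := congr1 (fun u : int => u%:~R : R[i]) xe.
  by rewrite !intrM intrD => <-; ring.
have -> : - cpi * ('i%C * d%:R + tau^-1) * (x%:~R + (beta n r)%:C%C) ^+ 2 =
  - ('i%C * cpi * d%:R * (beta n r)%:C%C ^+ 2) +
  2 * 'i%C * cpi * p%:R * r%:R / m.+1%:R +
  - cpi * (m.+1%:R ^+ 2 / tau) * (k%:~R + (p%:R + (beta n r)%:C%C) / m.+1%:R) ^+ 2
  + 2 * 'i%C * cpi * (r%:Z * k - d%:Z * T)%:~R.
  have -> : (r%:Z * k - d%:Z * T)%:~R = r%:R * k%:~R - d%:R * T%:~R :> R[i].
    by rewrite intrB !intrM.
  have -> : 2 * 'i%C * cpi * (r%:R * k%:~R - d%:R * T%:~R) =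
    'i%C * cpi * (2 * (r%:R * k%:~R) - d%:R * (2 * T%:~R)) by ring.
  rewrite -xeC xC bE NC.
  move: (tau^-1) => v; move: cpi (m.+1%:R : R[i]) m0 (d%:R : R[i]) d0 (k%:~R : R[i]).
  move=> c y y0 e e0 u.
  by field; rewrite y0 e0.
by rewrite [LHS]cexpD cexp_2pii mulr1.
Qed.

(** The shift by -i/d contributes the sign (-1)^(M j^2) and the characteristic N/2 the sign (-1)^(N
    j); they cancel because M and N are odd. *)
Lemma Psi_twist (n m d : nat) (t : R[i]) : n.+1 = (m.+1 * d)%N -> odd n.+1 ->
  Psi ((t - 'i%C / d%:R) * n.+1%:R) (n.+1%:R / 2) = Psi (t * n.+1%:R) 0.
Proof.
move=> nmd oN; have d0 : d%:R != 0 :> R[i].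
  by rewrite pnatr_eq0; case: d nmd => //; rewrite muln0.
have NC : n.+1%:R = m.+1%:R * d%:R :> R[i] by rewrite nmd natrM.
rewrite /Psi; congr csum; apply/funext => j; rewrite /Psi_term.
have oM : odd m.+1 by move: oN; rewrite nmd oddM => /andP[].
have e : m.+1%:Z * j ^+ 2 + n.+1%:Z * j = 2 * ((m.+1%:Z * j ^+ 2 + n.+1%:Z * j) %/ 2)%Z.
  by apply: int_even_half; apply: dvd2_odd_quadratic.
set T : int := (_ %/ 2)%Z in e.
have eC : m.+1%:R * j%:~R ^+ 2 + n.+1%:R * j%:~R = 2 * T%:~R :> R[i].
  have := congr1 (fun u : int => u%:~R : R[i]) e.
  by rewrite intrD !intrM => <-; rewrite expr2.
have hn : (n.+1%:R / 2 : R)%:C%C = n.+1%:R / 2.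
  by rewrite rmorphM fmorphV /= !rmorph_nat.
have -> : - cpi * ((t - 'i%C / d%:R) * n.+1%:R) * j%:~R ^+ 2 +
    2 * 'i%C * cpi * j%:~R * (n.+1%:R / 2 : R)%:C%C =
  - cpi * (t * n.+1%:R) * j%:~R ^+ 2 + 2 * 'i%C * cpi * T%:~R.
  have -> : 2 * 'i%C * cpi * T%:~R = 'i%C * cpi * (2 * T%:~R) by ring.
  rewrite -eC hn NC; move: cpi (m.+1%:R : R[i]) (d%:R : R[i]) d0 => c y w w0.
  by field; rewrite w0.
by rewrite [LHS]cexpD cexp_2pii rmorph0 mulr0 mulr1 addr0.
Qed.

Definition zeta8 : R[i] := cexp ('i%C * cpi / 4).

Lemma zeta8_sqr : zeta8 ^+ 2 = 'i%C.
Proof.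
rewrite /zeta8 -cexp_natM.
have -> : 2%:R * ('i%C * cpi / 4) = (0 +i* (pi / 2))%C.
  have -> : 2%:R * ('i%C * cpi / 4) = 'i%C * (pi / 2)%:C%C.
    by rewrite rmorphM fmorphV /= rmorph_nat -/cpi; move: cpi => c; field.
  by apply/eqP; rewrite eq_complex /= !(mul0r, mulr0, mul1r, oppr0, add0r, addr0) !eqxx.
rewrite /cexp /= expR0 cos_pihalf sin_pihalf.
by apply/eqP; rewrite eq_complex /= !(mul0r, mulr0, mul1r, oppr0, add0r, addr0) !eqxx.
Qed.

Lemma Re_zeta8M (D : R[i]) : in_sector D -> 0 < complex.Re (zeta8 * D).
Proof.
have pi0 := pi_gt0 R.
have cs : cos (pi / 4) = sin (pi / 4) :> R.
  by rewrite -cosN -[RHS]cosBpihalf; congr cos; lra.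
have c0 : 0 < cos (pi / 4) :> R by apply: cos_gt0_pihalf; apply/andP; split; lra.
have -> : zeta8 = (cos (pi / 4) +i* cos (pi / 4))%C.
  rewrite /zeta8.
  have -> : 'i%C * cpi / 4 = (0 +i* (pi / 4))%C.
    have -> : 'i%C * cpi / 4 = 'i%C * (pi / 4)%:C%C.
      by rewrite rmorphM fmorphV /= rmorph_nat -/cpi mulrA.
    by apply/eqP; rewrite eq_complex /= !(mul0r, mulr0, mul1r, oppr0, add0r, addr0) !eqxx.
  by rewrite /cexp /= expR0 -cs mul1r.
case: D => p q; rewrite /in_sector /= ltr_norml => /andP[h1 h2].
by rewrite -mulrBr mulr_gt0// subr_gt0.
Qed.

(* Determines the branch of the square root in the automorphy factor. *)
Lemma sector_roots (A B D : R[i]) (c : R) : 0 < c -> in_sector A -> in_sector B ->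
  in_sector D -> (c%:C%C * (A * B)) ^+ 2 = 'i%C * D ^+ 2 ->
  c%:C%C * (A * B) = zeta8 * D.
Proof.
move=> c0 sA sB sD; rewrite -zeta8_sqr -[RHS]exprMn => /eqP; rewrite eqf_sqr.
(* The opposite sign is impossible: A B has argument in (-pi/2, pi/2), and [zeta8] turns the sector
   of D into arguments in (0, pi/2), so both sides have positive real part. *)
move=> /orP[/eqP //|/eqP h].
have : 0 < complex.Re (c%:C%C * (A * B)).
  case: A B sA sB {h} => [a a'] [b b']; rewrite /in_sector /= !ltr_norml.
  move=> /andP[i1 i2] /andP[i3 i4]; rewrite mul0r subr0 mulr_gt0//; nra.
rewrite h {h}; have := Re_zeta8M sD; move: (zeta8 * D) => [u v] /= u0.
by rewrite oppr_gt0 ltNge ltW.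
Qed.

End cusp_expansion.

(** * Transformation formula and constant term *)

Section constant_term.
Variable R : realType.
Local Notation cpi := (@cpi R).

(** The factor [Psi] is kept on the left, to be removed in the limit by [cusp_lim_quot]. With J = dZ
    + 1 the N-th powers produce (B/D)^N = J^k (B/D), as (B/D)^2 = J and N = 2k + 1; the remaining
    B/D joins the root A from the denominator and gives [zeta8] / sqrt d. *)
Lemma f_theta_cusp (n m d k : nat) (Z : R[i]) :
  n.+1 = (m.+1 * d)%N -> n.+1 = k.*2.+1 -> 0 < complex.Im Z ->
  (d%:R * Z + 1) ^- k * f_theta n (Z / (d%:R * Z + 1)) *
    Psi (d%:R * (d%:R * Z + 1) / ('i%C * n.+1%:R)) 0 =
  zeta8 R / ((Num.sqrt n.+1%:R : R)%:C%C * (Num.sqrt d%:R : R)%:C%C) *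
  \sum_(r < n.+1) (phase R n d r * PsiAvg n m r (- 'i%C * Z)) ^+ n.+1.
Proof.
move=> nmd nk Z0.
have dgt0 : (0 < d)%N by case: d nmd => //; rewrite muln0.
have dR : 0 < d%:R :> R by rewrite ltr0n.
have dC : d%:R != 0 :> R[i] by rewrite pnatr_eq0 -lt0n.
have NR : 0 < n.+1%:R :> R by rewrite ltr0n.
have NC : n.+1%:R != 0 :> R[i] by rewrite pnatr_eq0.
have i0 : 'i%C != 0 :> R[i] by rewrite eq_complex /= oner_eq0 andbF.
have ii : 'i%C * 'i%C = -1 :> R[i] by rewrite -expr2 sqr_i.
set J := d%:R * Z + 1.
have JI : complex.Im J = d%:R * complex.Im Z.
  by rewrite /J -(rmorph_nat (real_complex R)); case: (Z) => a b /=; ring.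
have JIgt0 : 0 < complex.Im J by rewrite JI mulr_gt0.
have ZC : Z != 0 by apply/eqP => h; move: Z0; rewrite h ltxx.
have JC : J != 0 by apply/eqP => h; move: JIgt0; rewrite h ltxx.
have ReNi (w : R[i]) : complex.Re (- 'i%C * w) = complex.Im w.
  by case: w => a b /=; ring.
(* [t'] belongs to z' = Z/J = 1/d - 1/(dJ), so t' = t - i/d, the form treated by [Psi_twist]; its
   inverse is i d + 1/tau, the form treated by [Theta_cusp]. *)
pose tau := - 'i%C * Z; pose t' := - 'i%C * (Z / J).
pose t := 'i%C / (d%:R * J).
have tau0 : 0 < complex.Re tau by rewrite ReNi.
have tauC : tau != 0 by rewrite mulf_neq0// oppr_eq0.
have t'E : t'^-1 = 'i%C * d%:R + tau^-1.
  rewrite /t' /tau !invfM invrN invrK.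
  have -> : 'i%C^-1 = - 'i%C :> R[i].
    by apply: (mulfI i0); rewrite divff// mulrN ii opprK.
  by rewrite /J; field.
have t'0 : 0 < complex.Re t'.
  rewrite -[t']invrK; apply: Re_inv_gt0; rewrite t'E.
  have := Re_inv_gt0 tau0; case: (tau^-1) => a b.
  by rewrite -(rmorph_nat (real_complex R)) /= !(mul0r, mulr0) subrr add0r.
have t0 : 0 < complex.Re t.
  rewrite -[t]invrK; apply: Re_inv_gt0.
  have -> : t^-1 = d%:R * (- 'i%C * J).
    rewrite /t invf_div; apply: (mulIf i0); rewrite mulfVK//.
    have -> : d%:R * (- 'i%C * J) * 'i%C = - ('i%C * 'i%C) * d%:R * J by ring.
    by rewrite ii opprK mul1r.
  rewrite -(rmorph_nat (real_complex R)).
  have := JIgt0; rewrite -ReNi; case: (- 'i%C * J) => a b /= a0.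
  by rewrite mul0r subr0 mulr_gt0.
have [A sA At] := sector_sqrt t0; have [B sB Bt] := sector_sqrt tau0.
have [D sD Dt] := sector_sqrt t'0.
have D0 := sector_neq0 sD; have B0 := sector_neq0 sB; have A0 := sector_neq0 sA.
pose sN : R[i] := (Num.sqrt n.+1%:R : R)%:C%C.
pose sd : R[i] := (Num.sqrt d%:R : R)%:C%C.
have sN2 : sN ^+ 2 = n.+1%:R.
  by rewrite -rmorphXn /= sqr_sqrtr ?ltW// rmorph_nat.
have sd2 : sd ^+ 2 = d%:R by rewrite -rmorphXn /= sqr_sqrtr ?ltW// rmorph_nat.
have sN0 : sN != 0 by rewrite -sqrf_eq0 sN2.
have sd0 : sd != 0 by rewrite -sqrf_eq0 sd2.
(* The squares agree because d t tau = Z/J = i t'; [sector_roots] then selects the sign. *)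
have AB : sd * (A * B) = zeta8 R * D.
  apply: sector_roots => //; first by rewrite sqrtr_gt0.
  rewrite -/sd !exprMn sd2 At Bt Dt /t /tau /t'; field.
  by rewrite dC JC.
have numer r : Psi t' (beta R n r) = B / D * (phase R n d r * PsiAvg n m r tau).
  have := poisson_theta (beta R n r) (in_sectorV sD).
  rewrite exprVn Dt invrK t'E -Bt (Theta_cusp r sB nmd) => <-.
  by move: (phase _ _ _ _) (PsiAvg _ _ _ _) => u v; field.
have oN : odd n.+1 by rewrite nk /= odd_double.
have denom : sN * A * Psi (t' * n.+1%:R) (n.+1%:R / 2) = Psi (t * n.+1%:R)^-1 0.
  have -> : t' = t - 'i%C / d%:R by rewrite /t' /t /J; field; rewrite dC JC.
  rewrite (Psi_twist t nmd oN).
  have sNA : in_sector (sN * A) by apply: in_sectorZ; rewrite ?sqrtr_gt0.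
  have := poisson_theta 0 sNA; rewrite exprMn sN2 At (mulrC n.+1%:R) => <-.
  congr (_ * _); rewrite /Psi /Theta; congr csum; apply/funext => j.
  by rewrite /Psi_term rmorph0 mulr0 !addr0.
have -> : d%:R * J / ('i%C * n.+1%:R) = (t * n.+1%:R)^-1.
  rewrite /t; move: (n.+1%:R : R[i]) NC => y y0.
  by field; rewrite dC JC y0 i0.
rewrite -denom.
have z'0 : 0 < complex.Im (Z / J) by rewrite -ReNi.
have prod := theta_product n z'0; rewrite -/t' in prod.
have S_E : \sum_(r < n.+1) Psi t' (1 / 2 - r%:R / n.+1%:R) ^+ n.+1 =
  (B / D) ^+ n.+1 * \sum_(r < n.+1) (phase R n d r * PsiAvg n m r tau) ^+ n.+1.
  by rewrite mulr_sumr; apply: eq_bigr => r _; rewrite -exprMn -numer.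
rewrite S_E in prod; rewrite -/tau -/sN -/sd.
move: (f_theta n (Z / J)) (Psi (t' * n.+1%:R) _) prod => f P prod.
move: (\sum_(r < n.+1) _) prod => S prod.
have om : (B / D) ^+ 2 = J.
  by rewrite expr_div_n Bt Dt /tau /t'; field; rewrite i0 JC ZC.
have omN : (B / D) ^+ n.+1 = J ^+ k * (B / D).
  by rewrite nk exprSr -muln2 mulnC exprM om.
have omA : A * (B / D) = zeta8 R / sd.
  apply: (mulfI sd0); have -> : sd * (A * (B / D)) = sd * (A * B) / D by ring.
  by rewrite AB mulfK// mulrCA divff// mulr1.
have J0 : J ^+ k != 0 by rewrite expf_neq0.
apply: (mulfI NC); rewrite -sN2.
have -> : sN ^+ 2 * (J ^- k * f * (sN * A * P)) =
    sN * A * J ^- k * (sN ^+ 2 * (f * P)) by ring.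
rewrite sN2 -prod omN.
have -> : sN * A * J ^- k * (J ^+ k * (B / D) * S) =
   sN * (A * (B / D)) * S * (J ^+ k * J ^- k) by ring.
rewrite divff// mulr1 omA -sN2.
by field; rewrite sN0 sd0.
Qed.

Lemma cusp_lim_PsiAvg (n m r : nat) (b : int) :
  cusp_lim (fun z : R[i] => PsiAvg n m r (- 'i%C * (z + b%:~R)))
    (if (m.+1 %| r)%N then 1 else 0).
Proof.
have m0 : m.+1%:R != 0 :> R[i] by rewrite pnatr_eq0.
have mR : 0 < m.+1%:R :> R by rewrite ltr0n.
have -> : (if (m.+1 %| r)%N then 1 else 0) = m.+1%:R^-1 * \sum_(p < m.+1)
    cexp (2 * 'i%C * cpi * p%:R * r%:R / m.+1%:R) * 1.
  have := root_sum_int R m (- r%:Z); rewrite dvdzE abszN /= => h.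
  transitivity (m.+1%:R^-1 * (if (m.+1 %| r)%N then m.+1%:R else 0) : R[i]).
    by case: ifP => _; rewrite ?mulVf ?mulr0.
  rewrite -h; congr (_ * _); apply: eq_bigr => p _; rewrite mulr1; congr cexp.
  by rewrite mulrNz; ring.
apply: (cusp_limM (cusp_lim_cst _)); apply: cusp_lim_sum => p.
apply: (cusp_limM (cusp_lim_cst _)).
apply: (@cusp_lim_Psi R (m.+1%:R ^- 2)); first by rewrite invr_gt0 exprn_gt0.
move=> z; rewrite -intC -(rmorph_nat (real_complex R)) -rmorphXn -fmorphV /=.
by case: z => x y /=; ring.
Qed.

(** For r = qM one has N d beta^2 = N d / 4 - N q + M q^2, and M q^2 - N q is even. The surviving
    terms are therefore all equal, and their sum is a mere count. *)
Lemma phase_power (n m d r : nat) : n.+1 = (m.+1 * d)%N -> odd n.+1 ->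
  (m.+1 %| r)%N ->
  phase R n d r ^+ n.+1 = cexp (- ('i%C * cpi * (n.+1 * d)%:R / 4)).
Proof.
move=> nmd oN /dvdnP[q ->].
have d0 : d%:R != 0 :> R[i] by rewrite pnatr_eq0; case: d nmd => //; rewrite muln0.
have m0 : m.+1%:R != 0 :> R[i] by rewrite pnatr_eq0.
have NC : n.+1%:R = m.+1%:R * d%:R :> R[i] by rewrite nmd natrM.
have oM : odd m.+1 by move: oN; rewrite nmd oddM => /andP[].
have e := int_even_half (dvd2_odd_quadratic (- q%:Z) oM oN).
set T : int := (_ %/ 2)%Z in e.
have eC : m.+1%:R * q%:R ^+ 2 - n.+1%:R * q%:R = 2 * T%:~R :> R[i].
  have := congr1 (fun u : int => u%:~R : R[i]) e.
  by rewrite intrD !intrM mulrNz => <-; ring.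
rewrite /phase -cexp_natM /beta.
have -> : (1 / 2 - (q * m.+1)%:R / n.+1%:R : R)%:C%C = 1 / 2 - (q * m.+1)%:R / n.+1%:R.
  by rewrite rmorphB !rmorphM !fmorphV /= !rmorph_nat rmorph1.
have -> : n.+1%:R * - ('i%C * cpi * d%:R * (1 / 2 - (q * m.+1)%:R / n.+1%:R) ^+ 2) =
  - ('i%C * cpi * (n.+1 * d)%:R / 4) + 2 * 'i%C * cpi * (- T)%:~R.
  have -> : 2 * 'i%C * cpi * (- T)%:~R = - ('i%C * cpi * (2 * T%:~R)).
    by rewrite mulrNz; ring.
  rewrite -eC !natrM NC.
  move: cpi (m.+1%:R : R[i]) m0 (d%:R : R[i]) d0 (q%:R : R[i]) => c y y0 w w0 u.
  by field; rewrite y0 w0.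
by rewrite cexpD cexp_2pii mulr1.
Qed.

Lemma sum_dvdn (V : zmodType) (x : V) (m d : nat) :
  \sum_(r < m.+1 * d) (if (m.+1 %| r)%N then x else 0) = x *+ d.
Proof.
rewrite -(big_mkord xpredT (fun r => if (m.+1 %| r)%N then x else 0)).
elim: d => [|d IH]; first by rewrite muln0 big_nil mulr0n.
rewrite mulnS addnC (@big_cat_nat _ _ _ (m.+1 * d))//= ?leq_addr// IH mulrSr.
congr (_ + _); rewrite -{1}[(m.+1 * d)%N]add0n big_addn addKn big_mkord.
rewrite (bigD1 ord0)//= add0n dvdn_mulr// big1 ?addr0// => j j0.
rewrite dvdn_addl ?dvdn_mulr// gtnNdvd//.
by rewrite lt0n; apply: contra j0 => /eqP h; apply/eqP/val_inj.
Qed.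

End constant_term.

(* N and N * d are odd, so both integer divisions by 2 are exact. *)
Theorem theorem3p7 (R : realType) (N d : nat)
    (N_gt0 : (0 < N)%N) (N_sqf : squarefree N) (N_6 : gcdn N 6 = 1%N)
    (d_gt0 : (0 < d)%N) (d_N : (d %| N)%N) :
  cusp_constant_term ((N%:Z - 1) %/ 2)%Z (@f_theta R N.-1) 1 d
    ('i%C ^ ((1 - (N * d)%N%:Z) %/ 2)%Z * (Num.sqrt (d%:R / N%:R) : R)%:C%C).
Proof.
have oN : odd N.
  apply/negPn/negP => eN; have : (2 %| gcdn N 6)%N by rewrite dvdn_gcd dvdn2 eN.
  by rewrite N_6.
(* From here on N is [n.+1] and the cofactor M = N/d is [m.+1]; a zero cofactor is excluded by N >
   0. *)
move: N_gt0 d_N oN {N_sqf N_6}; case: N => [//|n] _ /dvdnP[[|m]] // nmd oN.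
have nk : n.+1 = n./2.*2.+1 by rewrite even_halfK//; move: oN => /=.
have kE : ((n.+1%:Z - 1) %/ 2)%Z = n./2%:Z by lia.
split; first by rewrite coprimezE coprime1n.
move=> b delta; rewrite mul1r => hdelta; apply: cusp_limP.
have dC : d%:R != 0 :> R[i] by rewrite pnatr_eq0 -lt0n.
have NC : n.+1%:R != 0 :> R[i] by rewrite pnatr_eq0.
have dR : 0 < d%:R :> R by rewrite ltr0n.
have NR : 0 < n.+1%:R :> R by rewrite ltr0n.
pose kappa : R[i] :=
  zeta8 R / ((Num.sqrt n.+1%:R : R)%:C%C * (Num.sqrt d%:R : R)%:C%C).
pose g (z : R[i]) := Psi (d%:R * (d%:R * (z + b%:~R) + 1) / ('i%C * n.+1%:R)) 0.
apply: (@cusp_lim_quot R _ g); last first.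
  apply: (@cusp_lim_Psi R (d%:R ^+ 2 / n.+1%:R)); first by rewrite divr_gt0 ?exprn_gt0.
  move=> z; have -> : d%:R * (d%:R * (z + b%:~R) + 1) / ('i%C * n.+1%:R) =
      (- 'i%C) * (d%:R * (d%:R * (z + b%:~R) + 1)) * (n.+1%:R)^-1.
    have i0 : 'i%C != 0 :> R[i] by rewrite eq_complex /= oner_eq0 andbF.
    rewrite invfM (_ : 'i%C^-1 = - 'i%C); first by ring.
    by apply: (mulfI i0); rewrite divff// mulrN -expr2 sqr_i opprK.
  rewrite -intC -!(rmorph_nat (real_complex R)) -fmorphV /=.
  by case: z => x y /=; ring.
have L := cusp_limM (cusp_lim_cst kappa) (cusp_lim_sum (index_enum 'I_n.+1)
  (fun r => cusp_limX n.+1 (cusp_limM (cusp_lim_cst (phase R n d r))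
    (cusp_lim_PsiAvg n m r b)))).
set l := (X in cusp_lim _ X).
have lE : kappa * \sum_(r < n.+1) (phase R n d r * (if (m.+1 %| r)%N then 1 else 0)) ^+ n.+1 = l.
  pose E := cexp (- ('i%C * cpi R * (n.+1 * d)%:R / 4)).
  have -> : \sum_(r < n.+1) (phase R n d r * (if (m.+1 %| r)%N then 1 else 0)) ^+ n.+1 = E *+ d.
    rewrite -(sum_dvdn _ m) -nmd; apply: eq_bigr => r _; case: ifP => mr.
      by rewrite mulr1 (phase_power R nmd oN mr).
    by rewrite mulr0 expr0n.
  have iE : 'i%C ^ ((1 - (n.+1 * d)%N%:Z) %/ 2)%Z = zeta8 R * E.
    have h : 2 * ((1 - (n.+1 * d)%N%:Z) %/ 2)%Z = 1 - (n.+1 * d)%N%:Z.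
      rewrite mulrC divzK//; have : odd (n.+1 * d).
        by rewrite oddM oN; move: oN; rewrite nmd oddM => /andP[].
      by move: (n.+1 * d)%N => u; lia.
    rewrite -zeta8_sqr (exprnP _ 2) exprz_exp h /zeta8 -cexp_intM -cexpD; congr cexp.
    by rewrite intrB -pmulrn; field.
  have sE : (Num.sqrt (d%:R / n.+1%:R) : R)%:C%C =
      (Num.sqrt d%:R : R)%:C%C / (Num.sqrt n.+1%:R : R)%:C%C.
    by rewrite sqrtrM ?ltW// sqrtrV ?ltW// rmorphM fmorphV.
  rewrite /l iE sE /kappa -[E *+ d]mulr_natr.
  have sd2 : (Num.sqrt d%:R : R)%:C%C ^+ 2 = d%:R.
    by rewrite -rmorphXn /= sqr_sqrtr ?ltW// rmorph_nat.
  have sN0 : (Num.sqrt n.+1%:R : R)%:C%C != 0.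
    by rewrite fmorph_eq0 gt_eqF// sqrtr_gt0.
  have sd0 : (Num.sqrt d%:R : R)%:C%C != 0 by rewrite fmorph_eq0 gt_eqF// sqrtr_gt0.
  rewrite -[in LHS]sd2; move: (zeta8 R) (E) (Num.sqrt n.+1%:R)%:C%C sN0 (Num.sqrt d%:R)%:C%C sd0.
  by move=> u v x x0 y y0; field; rewrite x0 y0.
rewrite -lE => e e0; have [M hM] := L e e0.
exists (Num.max M 0) => z; rewrite gt_max => /andP[/hM Mz z0].
have zb : 0 < complex.Im (z + b%:~R).
  by rewrite -intC; case: (z) z0 => x y /= y0; rewrite addr0.
have fE := f_theta_cusp nmd nk zb.
(* Every completion has delta = 1 + b d, so its automorphy factor is that of the translate z + b. *)
have JE : d%:R * z + delta%:~R = d%:R * (z + b%:~R) + 1.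
  have -> : delta = 1 + b * d%:Z by rewrite -hdelta; ring.
  by rewrite intrD intrM; ring.
by rewrite kE JE mul1r -exprnN /= /g fE.
Qed.
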